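(* Let $(\mathcal{C},\mathbb{E},\mathfrak{s})$ be an extriangulated category satisfying (WIC), let $\xi$ be a proper class of $\mathbb{E}$-triangles in $\mathcal{C}$, and assume that $\mathcal{C}$ has enough $\xi$-projectives and enough $\xi$-injectives. Let $M$ be an object of finite $\xi$-$\mathcal{G}$projective dimension and let $\mathfrak{E}: A\xrightarrow{x}B\xrightarrow{y}C\overset{\delta}{\dashrightarrow}$ be an $\mathbb{E}$-triangle in $\xi$. Then there exist morphisms $\widetilde{\partial}^n(M,\mathfrak{E}):\widetilde{\xi{\rm xt}}^n_{\mathcal{P}}(M,C)\to\widetilde{\xi{\rm xt}}^{n+1}_{\mathcal{P}}(M,A)$ ($n\in\mathbb{Z}$), natural in $M$ and $\mathfrak{E}$, such that the sequence $$\cdots\to\widetilde{\xi{\rm xt}}^n_{\mathcal{P}}(M,A)\xrightarrow{\widetilde{\xi{\rm xt}}^n_{\mathcal{P}}(M,x)}\widetilde{\xi{\rm xt}}^n_{\mathcal{P}}(M,B)\xrightarrow{\widetilde{\xi{\rm xt}}^n_{\mathcal{P}}(M,y)}\widetilde{\xi{\rm xt}}^n_{\mathcal{P}}(M,C)\xrightarrow{\widetilde{\partial}^n(M,\mathfrak{E})}\widetilde{\xi{\rm xt}}^{n+1}_{\mathcal{P}}(M,A)\to\cdots$$ is exact. Moreover, for each $n\in\mathbb{Z}$, $$\widetilde{\partial}^n(M,\mathfrak{E})\circ\widetilde{\varepsilon}^n_{\mathcal{P}}(M,C)=\widetilde{\varepsilon}^{n+1}_{\mathcal{P}}(M,A)\circ\partial^n(M,\mathfrak{E})$$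 as maps $\xi{\rm xt}^n_{\xi}(M,C)\to\widetilde{\xi{\rm xt}}^{n+1}_{\mathcal{P}}(M,A)$.
   Context: Extriangulated categories (Nakaoka--Palu). $\mathcal{C}$ is an additive category with an additive bifunctor $\mathbb{E}:\mathcal{C}^{\rm op}\times\mathcal{C}\to{\rm Ab}$. Elements $\delta\in\mathbb{E}(C,A)$ are $\mathbb{E}$-extensions; for $a:A\to A'$ and $c:C'\to C$ write $a_*\delta=\mathbb{E}(C,a)(\delta)$, $c^*\delta=\mathbb{E}(c,A)(\delta)$. A morphism $\delta\to\delta'$ ($\delta\in\mathbb{E}(C,A)$, $\delta'\in\mathbb{E}(C',A')$) is a pair $(a:A\to A',c:C\to C')$ with $a_*\delta=c^*\delta'$. Sequences $A\to B\to C$ and $A\to B'\to C$ are equivalent if there is an isomorphism $B\cong B'$ compatible with the maps. $\mathfrak{s}$ assigns to each $\delta\in\mathbb{E}(C,A)$ an equivalence class $\mathfrak{s}(\delta)=[A\xrightarrow{x}B\xrightarrow{y}C]$ such that every morphism $(a,c)$ of extensions lifts to a commutative $(a,b,c)$, with $\mathfrak{s}(0)=[A\to A\oplus C\to C]$ and $\mathfrak{s}(\delta\oplus\delta')=\mathfrak{s}(\delta)\oplus\mathfrak{s}(\delta')$. Axioms: (ET3) for $\delta,\delta'$ realized by $A\xrightarrow{x}B\xrightarrow{y}C$, $A'\xrightarrow{x'}B'\xrightarrow{y'}C'$ and $a,b$ with $bx=x'a$ there is $c$ with $cy=y'b$ and $a_*\delta=c^*\delta'$; (ET4) if $\delta\in\mathbb{E}(D,A)$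 is realized by $A\xrightarrow{f}B\xrightarrow{f'}D$ and $\delta'\in\mathbb{E}(F,B)$ by $B\xrightarrow{g}C\xrightarrow{g'}F$, there are an object $E$, maps $d:D\to E$, $e:E\to F$, $h':C\to E$ and $\delta''\in\mathbb{E}(E,A)$ realized by $A\xrightarrow{gf}C\xrightarrow{h'}E$ with $h'g=df'$, $eh'=g'$, $D\xrightarrow{d}E\xrightarrow{e}F$ realizing $f'_*\delta'$, $d^*\delta''=\delta$, $f_*\delta''=e^*\delta'$; and the duals of (ET3), (ET4). If $A\xrightarrow{x}B\xrightarrow{y}C$ realizes $\delta$, then $A\xrightarrow{x}B\xrightarrow{y}C\overset{\delta}{\dashrightarrow}$ is an $\mathbb{E}$-triangle, $x$ is an inflation and $y$ a deflation. It is split if $\delta=0$. A morphism of $\mathbb{E}$-triangles is a commutative triple $(a,b,c)$ with $a_*\delta=c^*\delta'$. (WIC): if $gf$ is an inflation then so is $f$; if $gf$ is a deflation then so is $g$. Proper class. A class $\xi$ of $\mathbb{E}$-triangles closed under isomorphisms is proper if: it is closed under finite coproducts and contains all split $\mathbb{E}$-triangles; it is closed under base change ($\delta\mapsto c^*\delta$) and cobase change ($\delta\mapsto a_*\delta$); and it is saturated: for $\mathbb{E}$-triangles $A_i\xrightarrow{x_i}B_i\xrightarrow{y_i}C\overset{\delta_i}{\dashrightarrow}$ ($i=1,2$), if the $\mathbb{E}$-triangles of $\delta_2$ and of $y_2^*\delta_1$ are in $\xi$, then so is that of $\delta_1$. Relative notions. $P$ is $\xi$-projective if $0\to\mathcal{C}(P,A)\to\mathcal{C}(P,B)\to\mathcal{C}(P,C)\to0$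 is exact for every $\mathbb{E}$-triangle $A\to B\to C\dashrightarrow$ in $\xi$; $\xi$-injective is dual. $\mathcal{P}(\xi)$ is the class of $\xi$-projectives. Enough $\xi$-projectives: each $A$ admits an $\mathbb{E}$-triangle $K\to P\to A\dashrightarrow$ in $\xi$ with $P\in\mathcal{P}(\xi)$; enough $\xi$-injectives is dual. Complexes are written homologically. A complex $\mathbf{X}$ is $\xi$-exact if for each $n$ there is an $\mathbb{E}$-triangle $K_{n+1}\xrightarrow{g_n}X_n\xrightarrow{f_n}K_n\dashrightarrow$ in $\xi$ with $d_n=g_{n-1}f_n$. A complete $\xi$-projective resolution is a $\xi$-exact complex of $\xi$-projectives (indexed by $\mathbb{Z}$) whose $\mathbb{E}$-triangles $K_{n+1}\to P_n\to K_n\dashrightarrow$ can be chosen so that $0\to\mathcal{C}(K_n,W)\to\mathcal{C}(P_n,W)\to\mathcal{C}(K_{n+1},W)\to0$ is exact for all $W\in\mathcal{P}(\xi)$; the objects $K_n$ are then called $\xi$-$\mathcal{G}$projective. The $\xi$-$\mathcal{G}$projective dimension is defined inductively: it is $0$ for $\xi$-$\mathcal{G}$projectives, and $\le n$ for $A$ if there is an $\mathbb{E}$-triangle $K\to G\to A\dashrightarrow$ in $\xi$ with $G$ $\xi$-$\mathcal{G}$projective and $K$ of $\xi$-$\mathcal{G}$projective dimension $\le n-1$. Cohomology. A $\xi$-projective resolution $\pi:\mathbf{P}\to M$ is a $\xi$-exact complex $\cdots\to P_1\to P_0\to M\to0$ with $P_n\in\mathcal{P}(\xi)$; $\xi{\rm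 xt}^n_{\xi}(M,N)=H^n(\mathcal{C}(\mathbf{P},N))$ (zero for $n<0$), where $H^n$ is the cohomology at $\mathcal{C}(P_n,N)$. For $\mathfrak{E}$ in $\xi$, $\partial^n(M,\mathfrak{E}):\xi{\rm xt}^n_{\xi}(M,C)\to\xi{\rm xt}^{n+1}_{\xi}(M,A)$ is the connecting map of the short exact sequence $0\to\mathcal{C}(\mathbf{P},A)\to\mathcal{C}(\mathbf{P},B)\to\mathcal{C}(\mathbf{P},C)\to0$. The $\xi$-complete cohomology is $\widetilde{\xi{\rm xt}}^n_{\mathcal{P}}(M,N)=H^n\big(\mathcal{C}(\mathbf{P}_M,\mathbf{P}_N)/\overline{\mathcal{C}}(\mathbf{P}_M,\mathbf{P}_N)\big)$, where $\mathbf{P}_M,\mathbf{P}_N$ are $\xi$-projective resolutions, $\mathcal{C}(\mathbf{P}_M,\mathbf{P}_N)$ is the Hom complex, $\overline{\mathcal{C}}$ is the subcomplex of families $(\varphi_i)$ with $\varphi_i=0$ for $i\gg0$, and $H^n$ is the homology in homological degree $-n$. A $\xi$-complete resolution of $M$ is a diagram $\mathbf{T}\xrightarrow{\nu}\mathbf{P}\xrightarrow{\pi}M$ with $\pi$ a $\xi$-projective resolution, $\mathbf{T}$ a complete $\xi$-projective resolution and $\nu$ a chain map with $\nu_i={\rm id}$ for $i\gg0$. It is known that every object $M$ of finite $\xi$-$\mathcal{G}$projective dimension admits one, and that then $\widetilde{\xi{\rm xt}}^n_{\mathcal{P}}(M,N)\cong H^n(\mathcal{C}(\mathbf{T},N))$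 for all $n\in\mathbb{Z}$ and all $N$, independently of choices and functorially; the groups are identified in this way. The comparison map $\widetilde{\varepsilon}^n_{\mathcal{P}}(M,N):\xi{\rm xt}^n_{\xi}(M,N)\to\widetilde{\xi{\rm xt}}^n_{\mathcal{P}}(M,N)$ is $H^n\mathcal{C}(\nu,N):H^n\mathcal{C}(\mathbf{P},N)\to H^n\mathcal{C}(\mathbf{T},N)$. *)

(* Defs.v *)
From HB Require Import structures.
From mathcomp Require Import all_boot all_order all_algebra.
From mathcomp Require Import ring_quotient.
From mathcomp Require Import boolp.
From mathcomp Require Import zify.

Set Implicit Arguments.
Unset Strict Implicit.
Unset Printing Implicit Defensive.

Import Order.TTheory GRing.Theory Num.Theory.
Local Open Scope ring_scope.
Local Open Scope quotient_scope.

Declare Scope cat_scope.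
Delimit Scope cat_scope with cat.
Local Open Scope cat_scope.

(* The relations to which [choose_or] is applied below are, by standard results
   on the objects concerned, total and single-valued (up to homotopy for
   [lift_chain]), so that the default value x0 is never used. *)
Definition choose_or (T : Type) (x0 : T) (P : T -> Prop) : T :=
  match pselect (exists x, P x) with
  | left h => projT1 (cid h)
  | right _ => x0
  end.

Record subgrp (V : zmodType) := Subgrp {
  sg_mem :> V -> Prop;
  sg_0 : sg_mem 0;
  sg_B : forall x y, sg_mem x -> sg_mem y -> sg_mem (x - y) }.

Section Subgroups.
Variables (V : zmodType) (S : subgrp V).

Definition sg_pred : {pred V} := fun x => `[< S x >].

Fact sg_pred_closed : zmod_closed sg_pred.
Proof.
split=> [|x y /asboolP Sx /asboolP Sy]; first exact/asboolP/sg_0.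
exact/asboolP/sg_B.
Qed.

HB.instance Definition _ := GRing.isZmodClosed.Build V sg_pred sg_pred_closed.

Record sub_of := SubOf { sub_val : V; _ : sub_val \in sg_pred }.

HB.instance Definition _ := [isSub for sub_val].
HB.instance Definition _ := [Choice of sub_of by <:].
HB.instance Definition _ := [SubChoice_isSubZmodule of sub_of by <:].

Definition to_sub (x : V) (Sx : S x) : sub_of := SubOf (asboolT Sx).

Lemma subP (u : sub_of) : S (sub_val u).
Proof. by case: u => x /= /asboolP. Qed.

Definition quo_of : zmodType := Quotient.quot sg_pred.
Definition quo_pi (x : V) : quo_of := \pi_(Quotient.quot sg_pred) x.
Definition quo_repr (u : quo_of) : V := repr (u : Quotient.quot sg_pred).

Lemma quo_piB x y : quo_pi (x - y) = quo_pi x - quo_pi y.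
Proof. by rewrite /quo_pi raddfB. Qed.

Lemma quo_reprK u : quo_pi (quo_repr u) = u.
Proof. exact: reprK. Qed.

Lemma quo_piP x y : quo_pi x = quo_pi y <-> S (x - y).
Proof.
split=> [/eqP|Sxy].
  by rewrite /quo_pi -Quotient.idealrBE => /asboolP.
by apply/eqP; rewrite /quo_pi -Quotient.idealrBE; apply/asboolP.
Qed.

Lemma quo_pi0 x : quo_pi x = 0 <-> S x.
Proof.
have -> : 0 = quo_pi 0 by rewrite -[X in quo_pi X](subrr 0) quo_piB subrr.
by rewrite quo_piP subr0.
Qed.

End Subgroups.

Definition quo_map (V W : zmodType) (S : subgrp V) (T : subgrp W)
  (f : V -> W) (u : quo_of S) : quo_of T := quo_pi T (f (quo_repr u)).

Lemma quo_map_pi (V W : zmodType) (S : subgrp V) (T : subgrp W) (f : V -> W) :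
    zmod_morphism f -> (forall x, S x -> T (f x)) ->
  forall x, quo_map T f (quo_pi S x) = quo_pi T (f x).
Proof.
move=> fB fS x; apply/quo_piP; rewrite -fB; apply: fS.
by apply/quo_piP; rewrite quo_reprK.
Qed.

Lemma quo_mapB (V W : zmodType) (S : subgrp V) (T : subgrp W) (f : V -> W) :
    zmod_morphism f -> (forall x, S x -> T (f x)) ->
  zmod_morphism (@quo_map V W S T f).
Proof.
move=> fB fS u v; rewrite -(quo_reprK u) -(quo_reprK v) -quo_piB.
by rewrite !(quo_map_pi fB fS) fB quo_piB.
Qed.

Definition exact_at (U V W : zmodType) (f : U -> V) (g : V -> W) : Prop :=
  forall v, g v = 0 <-> exists u, f u = v.

Definition short_exact (U V W : zmodType) (f : U -> V) (g : V -> W) : Prop :=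
  [/\ injective f, exact_at f g & forall w, exists v, g v = w].

(* The differential is given for all pairs of degrees and is zero unless the
   second is the successor of the first; this avoids transports along
   equations such as n - 1 + 1 = n. *)
Record abcx := AbCx {
  ab_ob :> int -> zmodType;
  ab_d : forall i j, ab_ob i -> ab_ob j;
  ab_dB : forall i j, zmod_morphism (@ab_d i j);
  ab_shape : forall i j x, j != i + 1 -> @ab_d i j x = 0;
  ab_dd : forall i j k x, @ab_d j k (@ab_d i j x) = 0 }.

Arguments ab_d K i j x : clear implicits, rename.

Lemma zmod_mor0 (V W : zmodType) (f : V -> W) : zmod_morphism f -> f 0 = 0.
Proof. by move=> fB; rewrite -(subrr 0) fB subrr. Qed.

Lemma zmod_morMz (V W : zmodType) (f : V -> W) (x : V) (z : int) :
  zmod_morphism f -> f (x *~ z) = f x *~ z.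
Proof.
move=> fB; pose fM := GRing.isZmodMorphism.Build V W f fB.
pose F : {additive V -> W} := HB.pack f fM.
exact: (raddfMz F).
Qed.

Section Cohomology.
Variables (K : abcx) (n : int).

Fact cocycle_0 : ab_d K n (n + 1) 0 = 0.
Proof. exact: (zmod_mor0 (@ab_dB K _ _)). Qed.

Fact cocycle_B x y : ab_d K n (n + 1) x = 0 -> ab_d K n (n + 1) y = 0 ->
  ab_d K n (n + 1) (x - y) = 0.
Proof. by move=> dx dy; rewrite ab_dB dx dy subrr. Qed.

Definition cocycle : subgrp (K n) :=
  @Subgrp (K n) (fun x => ab_d K n (n + 1) x = 0) cocycle_0 cocycle_B.

Fact coboundary_0 : exists y, ab_d K (n - 1) n y = sub_val (0 : sub_of cocycle).
Proof. by exists 0; rewrite (zmod_mor0 (@ab_dB K _ _)). Qed.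

Fact coboundary_B (x y : sub_of cocycle) :
    (exists t, ab_d K (n - 1) n t = sub_val x) ->
    (exists t, ab_d K (n - 1) n t = sub_val y) ->
  exists t, ab_d K (n - 1) n t = sub_val (x - y).
Proof. by move=> [s sE] [t tE]; exists (s - t); rewrite ab_dB sE tE. Qed.

Definition coboundary : subgrp (sub_of cocycle) :=
  @Subgrp (sub_of cocycle)
    (fun x => exists t, ab_d K (n - 1) n t = sub_val x)
    coboundary_0 coboundary_B.

Definition cohom : zmodType := quo_of coboundary.

(* x is a cocycle, of class u *)
Definition represents (u : cohom) (x : K n) : Prop :=
  exists z : sub_of cocycle, sub_val z = x /\ quo_pi coboundary z = u.

End Cohomology.

Record abmap (K L : abcx) := AbMap {
  am_fun :> forall n, K n -> L n;
  am_B : forall n, zmod_morphism (@am_fun n);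
  am_d : forall i j x, ab_d L i j (am_fun x) = am_fun (ab_d K i j x) }.

Section CohomologyMap.
Variables (K L : abcx) (f : abmap K L) (n : int).

Fact cocycle_map_subproof (z : sub_of (cocycle K n)) :
  cocycle L n (f n (sub_val z)).
Proof. by rewrite /= am_d (subP z) (zmod_mor0 (@am_B _ _ f _)). Qed.

Definition cocycle_map (z : sub_of (cocycle K n)) : sub_of (cocycle L n) :=
  to_sub (cocycle_map_subproof z).

Fact cocycle_mapB : zmod_morphism cocycle_map.
Proof. by move=> x y; apply: val_inj; rewrite /= am_B. Qed.

Fact cocycle_map_coboundary z : coboundary K n z -> coboundary L n (cocycle_map z).
Proof. by case=> t /= tE; exists (f _ t); rewrite am_d tE. Qed.

Definition cohom_map : cohom K n -> cohom L n :=
  quo_map (coboundary L n) cocycle_map.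

Lemma cohom_mapB : zmod_morphism cohom_map.
Proof. exact: quo_mapB cocycle_mapB cocycle_map_coboundary. Qed.

Lemma cohom_map_represents u x : represents u x -> represents (cohom_map u) (f n x).
Proof.
case=> z [<- <-]; exists (cocycle_map z); split=> //.
by rewrite /cohom_map (quo_map_pi cocycle_mapB cocycle_map_coboundary).
Qed.

End CohomologyMap.

(* The snake relation of a short exact sequence 0 -> K -> L -> Q -> 0. *)
Definition connecting_rel (K L Q : abcx) (i : abmap K L) (p : abmap L Q)
    (n : int) (u : cohom Q n) (w : cohom K (n + 1)) : Prop :=
  exists (l : L n) (k : K (n + 1)),
    [/\ represents u (p n l), i (n + 1) k = ab_d L n (n + 1) l
      & represents w k].

Definition connecting (K L Q : abcx) (i : abmap K L) (p : abmap L Q) (n : int)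
    (u : cohom Q n) : cohom K (n + 1) :=
  choose_or 0 (connecting_rel i p u).

Section QuotientComplex.
Variable K : abcx.

Record subcx := SubCx {
  sc_grp :> forall n, subgrp (K n);
  sc_d : forall i j x, sc_grp i x -> sc_grp j (ab_d K i j x) }.

Variable S : subcx.

Definition quocx_d i j : quo_of (S i) -> quo_of (S j) :=
  quo_map (S j) (ab_d K i j).

Fact quocx_dB i j : zmod_morphism (@quocx_d i j).
Proof. by apply: quo_mapB; [exact: ab_dB | exact: sc_d]. Qed.

Lemma quocx_d_pi i j x :
  quocx_d j (quo_pi (S i) x) = quo_pi (S j) (ab_d K i j x).
Proof. by apply: quo_map_pi; [exact: ab_dB | exact: sc_d]. Qed.

Fact quocx_shape i j x : j != i + 1 -> @quocx_d i j x = 0.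
Proof.
by move=> ij; rewrite -(quo_reprK x) quocx_d_pi ab_shape //; apply/quo_pi0/sg_0.
Qed.

Fact quocx_dd i j k x : @quocx_d j k (@quocx_d i j x) = 0.
Proof.
by rewrite -(quo_reprK x) !quocx_d_pi ab_dd; apply/quo_pi0/sg_0.
Qed.

Definition quocx : abcx :=
  @AbCx (fun n => quo_of (S n)) quocx_d quocx_dB quocx_shape quocx_dd.

Definition quocx_pi : abmap K quocx :=
  @AbMap K quocx (fun n => @quo_pi _ (S n)) (fun n => @quo_piB _ (S n))
    quocx_d_pi.

End QuotientComplex.

Section QuotientComplexMap.
Variables (K L : abcx) (S : subcx K) (T : subcx L) (f : abmap K L).
Hypothesis fST : forall n x, S n x -> T n (f n x).

Fact quocx_mapB n : zmod_morphism (@quo_map _ _ (S n) (T n) (f n)).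
Proof. by apply: quo_mapB; [exact: am_B | exact: fST]. Qed.

Fact quocx_map_d i j (x : quocx S i) :
  ab_d (quocx T) i j (quo_map (T i) (f i) x) =
  quo_map (T j) (f j) (ab_d (quocx S) i j x).
Proof.
rewrite -(quo_reprK x) [LHS]/= [RHS]/= quocx_d_pi.
rewrite !(quo_map_pi (@am_B _ _ f _) (@fST _)).
by rewrite quocx_d_pi am_d.
Qed.

Definition quocx_map : abmap (quocx S) (quocx T) :=
  @AbMap (quocx S) (quocx T) (fun n => quo_map (T n) (f n)) quocx_mapB
    quocx_map_d.

End QuotientComplexMap.

Record addcat := AddCat {
  ob :> Type;
  mor : ob -> ob -> zmodType;
  idm : forall A, mor A A;
  compm : forall A B C, mor B C -> mor A B -> mor A C;
  compmA : forall A B C D (h : mor C D) (g : mor B C) (f : mor A B),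
    compm h (compm g f) = compm (compm h g) f;
  comp1m : forall A B (f : mor A B), compm (idm B) f = f;
  compm1 : forall A B (f : mor A B), compm f (idm A) = f;
  compDl : forall A B C (g g' : mor B C) (f : mor A B),
    compm (g + g') f = compm g f + compm g' f;
  compDr : forall A B C (g : mor B C) (f f' : mor A B),
    compm g (f + f') = compm g f + compm g f';
  zob : ob;
  zobP : idm zob = 0;
  bip : ob -> ob -> ob;
  in1 : forall A B, mor A (bip A B);
  in2 : forall A B, mor B (bip A B);
  pr1 : forall A B, mor (bip A B) A;
  pr2 : forall A B, mor (bip A B) B;
  pr1_in1 : forall A B, compm (pr1 A B) (in1 A B) = idm A;
  pr2_in2 : forall A B, compm (pr2 A B) (in2 A B) = idm B;
  pr1_in2 : forall A B, compm (pr1 A B) (in2 A B) = 0;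
  pr2_in1 : forall A B, compm (pr2 A B) (in1 A B) = 0;
  bip_sum : forall A B,
    compm (in1 A B) (pr1 A B) + compm (in2 A B) (pr2 A B) = idm (bip A B) }.

Arguments idm {a} A.
Arguments zob {a}.
Arguments bip {a} A B.
Arguments in1 {a} A B.
Arguments in2 {a} A B.
Arguments pr1 {a} A B.
Arguments pr2 {a} A B.

Notation "g ∘ f" := (compm g f) (at level 40, left associativity) : cat_scope.
Notation "A ⊕ B" := (bip A B) (at level 50, left associativity) : cat_scope.

Section AdditiveCategory.
Variable C : addcat.
Implicit Types A B : C.

Lemma comp0l A B D (f : mor A B) : (0 : mor B D) ∘ f = 0.
Proof. by apply: (@addrI _ (0 ∘ f)); rewrite -compDl !addr0. Qed.

Lemma comp0r A B D (g : mor B D) : g ∘ (0 : mor A B) = 0.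
Proof. by apply: (@addrI _ (g ∘ 0)); rewrite -compDr !addr0. Qed.

Lemma compNl A B D (g : mor B D) (f : mor A B) : (- g) ∘ f = - (g ∘ f).
Proof. by apply: (@addrI _ (g ∘ f)); rewrite -compDl !subrr comp0l. Qed.

Lemma compNr A B D (g : mor B D) (f : mor A B) : g ∘ (- f) = - (g ∘ f).
Proof. by apply: (@addrI _ (g ∘ f)); rewrite -compDr !subrr comp0r. Qed.

Lemma compBl A B D (g g' : mor B D) (f : mor A B) :
  (g - g') ∘ f = g ∘ f - g' ∘ f.
Proof. by rewrite compDl compNl. Qed.

Lemma compBr A B D (g : mor B D) (f f' : mor A B) :
  g ∘ (f - f') = g ∘ f - g ∘ f'.
Proof. by rewrite compDr compNr. Qed.

Lemma compMzl A B D (g : mor B D) (f : mor A B) (z : int) :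
  (g *~ z) ∘ f = (g ∘ f) *~ z.
Proof. exact: (@zmod_morMz _ _ (fun g' => g' ∘ f) g z (fun g g' => compBl g g' f)). Qed.

Lemma compMzr A B D (g : mor B D) (f : mor A B) (z : int) :
  g ∘ (f *~ z) = (g ∘ f) *~ z.
Proof. exact: (@zmod_morMz _ _ (compm g) f z (compBr g)). Qed.

Definition is_zero A : Prop := idm A = 0.

Definition is_iso A B (f : mor A B) : Prop :=
  exists g : mor B A, g ∘ f = idm A /\ f ∘ g = idm B.

Definition eqhom A B (e : A = B) : mor A B :=
  match e with erefl => idm A end.

Definition bipm A A' B B' (f : mor A B) (f' : mor A' B') :
    mor (A ⊕ A') (B ⊕ B') :=
  in1 B B' ∘ f ∘ pr1 A A' + in2 B B' ∘ f' ∘ pr2 A A'.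

End AdditiveCategory.

(* [EE C A] is the group of extensions usually written E(C, A);
   [push a d] is a_* d and [pull c d] is c^* d. *)
Record addbifunctor (C : addcat) := AddBifunctor {
  EE : C -> C -> zmodType;
  push : forall X A A', mor A A' -> EE X A -> EE X A';
  pull : forall X X' A, mor X' X -> EE X A -> EE X' A;
  pushD : forall X A A' (a : mor A A') (d d' : EE X A),
    push a (d + d') = push a d + push a d';
  pullD : forall X X' A (c : mor X' X) (d d' : EE X A),
    pull c (d + d') = pull c d + pull c d';
  push_addm : forall X A A' (a a' : mor A A') (d : EE X A),
    push (a + a') d = push a d + push a' d;
  pull_addm : forall X X' A (c c' : mor X' X) (d : EE X A),
    pull (c + c') d = pull c d + pull c' d;
  push1 : forall X A (d : EE X A), push (idm A) d = d;
  pull1 : forall X A (d : EE X A), pull (idm X) d = d;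
  push_comp : forall X A A' A'' (a' : mor A' A'') (a : mor A A') (d : EE X A),
    push (a' ∘ a) d = push a' (push a d);
  pull_comp : forall X X' X'' A (c : mor X' X) (c' : mor X'' X') (d : EE X A),
    pull (c ∘ c') d = pull c' (pull c d);
  push_pull : forall X X' A A' (a : mor A A') (c : mor X' X) (d : EE X A),
    push a (pull c d) = pull c (push a d) }.

Section Realizations.
Variables (C : addcat) (F : addbifunctor C).

Definition seq_equiv (A B B' X : C) (x : mor A B) (y : mor B X)
    (x' : mor A B') (y' : mor B' X) : Prop :=
  exists b : mor B B', [/\ is_iso b, b ∘ x = x' & y' ∘ b = y].

Definition ext_sum (A X A' X' : C) (d : EE F X A) (d' : EE F X' A') :
    EE F (X ⊕ X') (A ⊕ A') :=
  push (in1 A A') (pull (pr1 X X') d) + push (in2 A A') (pull (pr2 X X') d').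

(* s(d) is given through the relation "the sequence (x, y) belongs to the
   class s(d)". *)
Variable s : forall A B X : C, mor A B -> mor B X -> EE F X A -> Prop.

Definition assigns_classes : Prop :=
  forall (A X : C) (d : EE F X A),
    exists (B : C) (x : mor A B) (y : mor B X),
      forall (B' : C) (x' : mor A B') (y' : mor B' X),
        s x' y' d <-> seq_equiv x y x' y'.

Definition lifts_morphisms : Prop :=
  forall (A B X A' B' X' : C) (x : mor A B) (y : mor B X) (d : EE F X A)
      (x' : mor A' B') (y' : mor B' X') (d' : EE F X' A')
      (a : mor A A') (c : mor X X'),
    s x y d -> s x' y' d' -> push a d = pull c d' ->
    exists b : mor B B', b ∘ x = x' ∘ a /\ y' ∘ b = c ∘ y.

Definition additive_realization : Prop :=
  (forall A X : C, s (in1 A X) (pr2 A X) 0) /\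
  (forall (A B X A' B' X' : C) (x : mor A B) (y : mor B X) (d : EE F X A)
      (x' : mor A' B') (y' : mor B' X') (d' : EE F X' A'),
    s x y d -> s x' y' d' -> s (bipm x x') (bipm y y') (ext_sum d d')).

Definition ET3 : Prop :=
  forall (A B X A' B' X' : C) (x : mor A B) (y : mor B X) (d : EE F X A)
      (x' : mor A' B') (y' : mor B' X') (d' : EE F X' A')
      (a : mor A A') (b : mor B B'),
    s x y d -> s x' y' d' -> b ∘ x = x' ∘ a ->
    exists c : mor X X', c ∘ y = y' ∘ b /\ push a d = pull c d'.

Definition ET3op : Prop :=
  forall (A B X A' B' X' : C) (x : mor A B) (y : mor B X) (d : EE F X A)
      (x' : mor A' B') (y' : mor B' X') (d' : EE F X' A')
      (b : mor B B') (c : mor X X'),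
    s x y d -> s x' y' d' -> c ∘ y = y' ∘ b ->
    exists a : mor A A', b ∘ x = x' ∘ a /\ push a d = pull c d'.

Definition ET4 : Prop :=
  forall (A B D X Z : C) (f : mor A B) (f' : mor B D) (d : EE F D A)
      (g : mor B X) (g' : mor X Z) (d' : EE F Z B),
    s f f' d -> s g g' d' ->
    exists (Y : C) (k : mor D Y) (e : mor Y Z) (h' : mor X Y) (d'' : EE F Y A),
      [/\ s (g ∘ f) h' d'', h' ∘ g = k ∘ f' & e ∘ h' = g'] /\
      [/\ s k e (push f' d'), pull k d'' = d & push f d'' = pull e d'].

Definition ET4op : Prop :=
  forall (A B D X Z : C) (f : mor B A) (f' : mor D B) (d : EE F A D)
      (g : mor X B) (g' : mor Z X) (d' : EE F B Z),
    s f' f d -> s g' g d' ->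
    exists (Y : C) (k : mor Y D) (e : mor Z Y) (h' : mor Y X) (d'' : EE F A Y),
      [/\ s h' (f ∘ g) d'', g ∘ h' = f' ∘ k & h' ∘ e = g'] /\
      [/\ s e k (pull f' d'), push k d'' = d & pull f d'' = push e d'].

End Realizations.

Record extricat := ExtriCat {
  ec_cat :> addcat;
  ec_E : addbifunctor ec_cat;
  realizes : forall A B X : ec_cat, mor A B -> mor B X -> EE ec_E X A -> Prop;
  ec_classes : assigns_classes realizes;
  ec_lifts : lifts_morphisms realizes;
  ec_additive : additive_realization realizes;
  ec_ET3 : ET3 realizes;
  ec_ET3op : ET3op realizes;
  ec_ET4 : ET4 realizes;
  ec_ET4op : ET4op realizes }.

Arguments realizes {e A B X} x y d : rename.

Section Inflations.
Variable C : extricat.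

Definition inflation (A B : C) (x : mor A B) : Prop :=
  exists (X : C) (y : mor B X) (d : EE (ec_E C) X A), realizes x y d.

Definition deflation (B X : C) (y : mor B X) : Prop :=
  exists (A : C) (x : mor A B) (d : EE (ec_E C) X A), realizes x y d.

Definition WIC : Prop :=
  (forall (A B X : C) (f : mor A B) (g : mor B X),
     inflation (g ∘ f) -> inflation f) /\
  (forall (A B X : C) (f : mor A B) (g : mor B X),
     deflation (g ∘ f) -> deflation g).

End Inflations.

Record properclass (C : extricat) := ProperClass {
  xi_in : forall A B X : C, mor A B -> mor B X -> EE (ec_E C) X A -> Prop;
  xi_real : forall (A B X : C) (x : mor A B) (y : mor B X) (d : EE (ec_E C) X A),
    xi_in x y d -> realizes x y d;
  xi_iso : forall (A B X A' B' X' : C)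
      (x : mor A B) (y : mor B X) (d : EE (ec_E C) X A)
      (x' : mor A' B') (y' : mor B' X') (d' : EE (ec_E C) X' A')
      (a : mor A A') (b : mor B B') (c : mor X X'),
    xi_in x y d -> realizes x' y' d' ->
    is_iso a -> is_iso b -> is_iso c ->
    b ∘ x = x' ∘ a -> c ∘ y = y' ∘ b -> push a d = pull c d' ->
    xi_in x' y' d';
  xi_split : forall (A B X : C) (x : mor A B) (y : mor B X),
    realizes x y 0 -> xi_in x y 0;
  xi_sum : forall (A B X A' B' X' : C)
      (x : mor A B) (y : mor B X) (d : EE (ec_E C) X A)
      (x' : mor A' B') (y' : mor B' X') (d' : EE (ec_E C) X' A'),
    xi_in x y d -> xi_in x' y' d' ->
    xi_in (bipm x x') (bipm y y') (ext_sum d d');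
  xi_pull : forall (A B X : C) (x : mor A B) (y : mor B X) (d : EE (ec_E C) X A)
      (X' B' : C) (c : mor X' X) (x' : mor A B') (y' : mor B' X'),
    xi_in x y d -> realizes x' y' (pull c d) -> xi_in x' y' (pull c d);
  xi_push : forall (A B X : C) (x : mor A B) (y : mor B X) (d : EE (ec_E C) X A)
      (A' B' : C) (a : mor A A') (x' : mor A' B') (y' : mor B' X),
    xi_in x y d -> realizes x' y' (push a d) -> xi_in x' y' (push a d);
  xi_saturated : forall (X A1 B1 A2 B2 : C)
      (x1 : mor A1 B1) (y1 : mor B1 X) (d1 : EE (ec_E C) X A1)
      (x2 : mor A2 B2) (y2 : mor B2 X) (d2 : EE (ec_E C) X A2)
      (D : C) (u : mor A1 D) (v : mor D B2),
    realizes x1 y1 d1 -> xi_in x2 y2 d2 -> xi_in u v (pull y2 d1) ->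
    xi_in x1 y1 d1 }.

Record xitri (C : extricat) (xi : properclass C) := XiTri {
  tA : C;
  tB : C;
  tC : C;
  tx : mor tA tB;
  ty : mor tB tC;
  td : EE (ec_E C) tC tA;
  t_in : xi_in xi tx ty td }.

Definition tri_morphism (C : extricat) (xi : properclass C) (t t' : xitri xi)
    (a : mor (tA t) (tA t')) (b : mor (tB t) (tB t')) (c : mor (tC t) (tC t')) :
    Prop :=
  [/\ b ∘ tx t = tx t' ∘ a, c ∘ ty t = ty t' ∘ b
    & push a (td t) = pull c (td t')].

Section Projectives.
Variables (C : extricat) (xi : properclass C).

Definition xi_projective (P : C) : Prop :=
  forall (A B X : C) (x : mor A B) (y : mor B X) (d : EE (ec_E C) X A),
    xi_in xi x y d ->
    short_exact (fun f : mor P A => x ∘ f) (fun f : mor P B => y ∘ f).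

Definition xi_injective (I : C) : Prop :=
  forall (A B X : C) (x : mor A B) (y : mor B X) (d : EE (ec_E C) X A),
    xi_in xi x y d ->
    short_exact (fun f : mor X I => f ∘ y) (fun f : mor B I => f ∘ x).

Definition enough_projectives : Prop :=
  forall A : C, exists (K P : C) (x : mor K P) (y : mor P A)
    (d : EE (ec_E C) A K), xi_projective P /\ xi_in xi x y d.

Definition enough_injectives : Prop :=
  forall A : C, exists (I K : C) (x : mor A I) (y : mor I K)
    (d : EE (ec_E C) K A), xi_injective I /\ xi_in xi x y d.

End Projectives.

(* Homological indexing: the only possibly nonzero differentials are the
   cx_d (n + 1) n. *)
Record complex (C : addcat) := Complex {
  cx_ob :> int -> C;
  cx_d : forall i j, mor (cx_ob i) (cx_ob j);
  cx_shape : forall i j, i != j + 1 -> cx_d i j = 0;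
  cx_dd : forall i j k, cx_d j k ∘ cx_d i j = 0 }.

Record chainmap (C : addcat) (X Y : complex C) := ChainMap {
  cm_fun :> forall i, mor (X i) (Y i);
  cm_d : forall i j, cx_d Y i j ∘ cm_fun i = cm_fun j ∘ cx_d X i j }.

Section Complexes.
Variable C : addcat.
Implicit Types X Y : complex C.

Fact chainmap0_d X Y i j :
  cx_d Y i j ∘ (0 : mor (X i) (Y i)) = (0 : mor (X j) (Y j)) ∘ cx_d X i j.
Proof. by rewrite comp0l comp0r. Qed.

Definition chainmap0 X Y : chainmap X Y := ChainMap (@chainmap0_d X Y).

(* The complex C(X, N), with C(X_n, N) in degree n. *)
Section HomInto.
Variables (X : complex C) (N : C).

Definition homN_d i j (f : mor (X i) N) : mor (X j) N := f ∘ cx_d X j i.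

Fact homN_dB i j : zmod_morphism (@homN_d i j).
Proof. by move=> f g; rewrite /homN_d compBl. Qed.

Fact homN_shape i j f : j != i + 1 -> @homN_d i j f = 0.
Proof. by move=> ij; rewrite /homN_d cx_shape // comp0r. Qed.

Fact homN_dd i j k f : @homN_d j k (@homN_d i j f) = 0.
Proof. by rewrite /homN_d -compmA cx_dd comp0r. Qed.

Definition homN : abcx :=
  @AbCx (fun n => mor (X n) N) homN_d homN_dB homN_shape homN_dd.

End HomInto.

Section HomIntoMaps.
Variables (X X' : complex C) (N N' : C).

Fact homN_post_B (f : mor N N') n :
  zmod_morphism (fun u : homN X N n => f ∘ u : homN X N' n).
Proof. by move=> u v; rewrite compBr. Qed.

Fact homN_post_d (f : mor N N') i j (u : homN X N i) :
  ab_d (homN X N') i j (f ∘ u) = f ∘ ab_d (homN X N) i j u.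
Proof. by rewrite /= /homN_d compmA. Qed.

Definition homN_post (f : mor N N') : abmap (homN X N) (homN X N') :=
  AbMap (homN_post_B f) (homN_post_d f).

Fact homN_pre_B (h : chainmap X' X) n :
  zmod_morphism (fun u : homN X N n => u ∘ h n : homN X' N n).
Proof. by move=> u v; rewrite compBl. Qed.

Fact homN_pre_d (h : chainmap X' X) i j (u : homN X N i) :
  ab_d (homN X' N) i j (u ∘ h i) = ab_d (homN X N) i j u ∘ h j.
Proof. by rewrite /= /homN_d -!compmA cm_d. Qed.

Definition homN_pre (h : chainmap X' X) : abmap (homN X N) (homN X' N) :=
  AbMap (homN_pre_B h) (homN_pre_d h).

End HomIntoMaps.

(* Families of morphisms X_i -> Y_j for all i and j; the elements of degree n
   of the Hom complex are those with phi i j = 0 unless i = j + n. *)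
Definition fam X Y := forall i j : int, mor (X i) (Y j).

Section Families.
Variables X Y : complex C.

HB.instance Definition _ := gen_eqMixin (fam X Y).
HB.instance Definition _ := gen_choiceMixin (fam X Y).

Lemma famP (phi psi : fam X Y) : (forall i j, phi i j = psi i j) -> phi = psi.
Proof. by move=> e; do 2!apply: functional_extensionality_dep => ?. Qed.

Definition fam_zero : fam X Y := fun i j => 0.
Definition fam_opp (phi : fam X Y) : fam X Y := fun i j => - phi i j.
Definition fam_add (phi psi : fam X Y) : fam X Y := fun i j => phi i j + psi i j.

Fact fam_addA : associative fam_add.
Proof. by move=> p q r; apply: famP => i j; exact: addrA. Qed.
Fact fam_addC : commutative fam_add.
Proof. by move=> p q; apply: famP => i j; exact: addrC. Qed.
Fact fam_add0 : left_id fam_zero fam_add.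
Proof. by move=> p; apply: famP => i j; exact: add0r. Qed.
Fact fam_addN : left_inverse fam_zero fam_opp fam_add.
Proof. by move=> p; apply: famP => i j; exact: addNr. Qed.

HB.instance Definition _ :=
  GRing.isZmodule.Build (fam X Y) fam_addA fam_addC fam_add0 fam_addN.

Fact degree_0 (n : int) : forall i j, i != j + n -> (0 : fam X Y) i j = 0.
Proof. by []. Qed.

Fact degree_B (n : int) (p q : fam X Y) :
    (forall i j, i != j + n -> p i j = 0) ->
    (forall i j, i != j + n -> q i j = 0) ->
  forall i j, i != j + n -> (p - q) i j = 0.
Proof.
move=> hp hq i j ij.
by rewrite -[(p - q) i j]/(p i j - q i j) hp // hq // subrr.
Qed.

Definition degree (n : int) : subgrp (fam X Y) :=
  @Subgrp (fam X Y) (fun p => forall i j, i != j + n -> p i j = 0)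
    (@degree_0 n) (@degree_B n).

End Families.

(* (-1)^n *)
Definition sgn (n : int) : int := (-1) ^+ `|n|%N.

Lemma sgnS n : sgn (n + 1) = - sgn n.
Proof.
rewrite /sgn -signr_odd -[in RHS]signr_odd.
have -> : odd `|n + 1| = ~~ odd `|n| by lia.
by case: (odd _).
Qed.

(* The Hom complex C(X, Y), cohomologically graded: the elements of degree n
   are the families X_i -> Y_{i-n}, with
   (d phi)_i = d phi_i - (-1)^n phi_{i-1} d. *)
Section HomComplex.
Variables X Y : complex C.

Definition homcx_diff (n : int) (p : fam X Y) : fam X Y := fun i j =>
  cx_d Y (j + 1) j ∘ p i (j + 1) - (p (i - 1) j ∘ cx_d X i (i - 1)) *~ sgn n.

Fact homcx_diffB n : zmod_morphism (homcx_diff n).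
Proof.
move=> p q; apply: famP => i j.
rewrite /homcx_diff -[RHS]/(homcx_diff n p i j - homcx_diff n q i j).
rewrite -[(p - q) i _]/(p i (j + 1) - q i (j + 1)).
rewrite -[(p - q) _ j]/(p (i - 1) j - q (i - 1) j).
rewrite compBr compBl mulrzBl /homcx_diff.
by rewrite !opprD !opprK addrACA.
Qed.

Definition homcx_ob (n : int) : zmodType := sub_of (degree X Y n).

Definition homcx_d_fam (n m : int) (p : homcx_ob n) : fam X Y :=
  if m == n + 1 then homcx_diff n (sub_val p) else 0.

Fact homcx_d_degree n m p : degree X Y m (@homcx_d_fam n m p).
Proof.
rewrite /homcx_d_fam; case: eqP => [->|_]; last exact: sg_0.
move=> i j ij; rewrite /homcx_diff !(subP p) ?comp0l ?comp0r ?mul0rz ?subrr //.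
  by apply: contra ij => /eqP e; apply/eqP; lia.
by apply: contra ij => /eqP e; apply/eqP; lia.
Qed.

Definition homcx_d n m (p : homcx_ob n) : homcx_ob m :=
  to_sub (@homcx_d_degree n m p).

Fact homcx_dB n m : zmod_morphism (@homcx_d n m).
Proof.
move=> p q; apply: val_inj; rewrite /= /homcx_d_fam.
by case: eqP => _ /=; rewrite ?subrr // homcx_diffB.
Qed.

Fact homcx_shape n m p : m != n + 1 -> @homcx_d n m p = 0.
Proof.
by move=> /negPf nm; apply: val_inj; rewrite /= /homcx_d_fam nm.
Qed.

Fact homcx_dd n m k p : @homcx_d m k (@homcx_d n m p) = 0.
Proof.
apply: val_inj; rewrite /= /homcx_d_fam; case: eqP => //= _.
rewrite /homcx_d_fam; case: eqP => [->|_]; last exact: (zmod_mor0 (homcx_diffB _)).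
apply: famP => i j; rewrite [RHS]/= /homcx_diff sgnS mulrNz opprK.
rewrite compBr compmA cx_dd comp0l sub0r compBl -!compmA.
by rewrite compMzl compMzr -!compmA cx_dd comp0r !mul0rz subr0 addNr.
Qed.

Definition homcx : abcx :=
  @AbCx homcx_ob homcx_d homcx_dB homcx_shape homcx_dd.

Fact bounded_0 n : exists m : int, forall i j, m <= i ->
  sub_val (0 : homcx n) i j = 0.
Proof. by exists 0. Qed.

Fact bounded_B n (p q : homcx n) :
    (exists m : int, forall i j, m <= i -> sub_val p i j = 0) ->
    (exists m : int, forall i j, m <= i -> sub_val q i j = 0) ->
  exists m : int, forall i j, m <= i -> sub_val (p - q) i j = 0.
Proof.
case=> m hm [k hk]; exists (Num.max m k) => i j; rewrite ge_max => /andP[mi ki].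
by rewrite -[LHS]/(sub_val p i j - sub_val q i j) hm // hk // subrr.
Qed.

Definition bounded_grp (n : int) : subgrp (homcx n) :=
  @Subgrp (homcx n)
    (fun p => exists m : int, forall i j, m <= i -> sub_val p i j = 0)
    (@bounded_0 n) (@bounded_B n).

Fact bounded_d n k p : bounded_grp n p -> bounded_grp k (ab_d homcx n k p).
Proof.
case=> m hm; exists (m + 1) => i j mi /=; rewrite /homcx_d_fam.
case: eqP => // _; rewrite /homcx_diff !hm ?comp0l ?comp0r ?mul0rz ?subrr //; lia.
Qed.

(* The subcomplex of the families that vanish for i >> 0. *)
Definition bounded : subcx homcx := SubCx bounded_d.

Definition stabcx : abcx := quocx bounded.

End HomComplex.

Section HomComplexMaps.
Variables (X X' Y Y' : complex C).

Section Pre.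
Variable h : chainmap X' X.

Fact homcx_pre_degree n (p : homcx X Y n) :
  degree X' Y n (fun i j => sub_val p i j ∘ h i).
Proof. by move=> i j ij; rewrite (subP p) // comp0l. Qed.

Definition homcx_pre_fun n (p : homcx X Y n) : homcx X' Y n :=
  to_sub (homcx_pre_degree p).

Fact homcx_pre_B n : zmod_morphism (@homcx_pre_fun n).
Proof. by move=> p q; apply: val_inj; apply: famP => i j; exact: compBl. Qed.

Fact homcx_pre_d n m (p : homcx X Y n) :
  ab_d (homcx X' Y) n m (homcx_pre_fun p) = homcx_pre_fun (ab_d (homcx X Y) n m p).
Proof.
apply: val_inj; apply: famP => i j; rewrite /= /homcx_d_fam.
case: eqP => _; last by rewrite comp0l.
rewrite /homcx_diff /= compBl compmA; congr (_ - _).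
by rewrite compMzl -!compmA cm_d.
Qed.

Definition homcx_pre : abmap (homcx X Y) (homcx X' Y) :=
  AbMap homcx_pre_B homcx_pre_d.

Fact homcx_pre_bounded n p : bounded X Y n p -> bounded X' Y n (homcx_pre n p).
Proof. by case=> m hm; exists m => i j mi /=; rewrite hm // comp0l. Qed.

Definition stabcx_pre : abmap (stabcx X Y) (stabcx X' Y) :=
  quocx_map homcx_pre_bounded.

End Pre.

Section Post.
Variable h : chainmap Y Y'.

Fact homcx_post_degree n (p : homcx X Y n) :
  degree X Y' n (fun i j => h j ∘ sub_val p i j).
Proof. by move=> i j ij; rewrite (subP p) // comp0r. Qed.

Definition homcx_post_fun n (p : homcx X Y n) : homcx X Y' n :=
  to_sub (homcx_post_degree p).

Fact homcx_post_B n : zmod_morphism (@homcx_post_fun n).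
Proof. by move=> p q; apply: val_inj; apply: famP => i j; exact: compBr. Qed.

Fact homcx_post_d n m (p : homcx X Y n) :
  ab_d (homcx X Y') n m (homcx_post_fun p) =
  homcx_post_fun (ab_d (homcx X Y) n m p).
Proof.
apply: val_inj; apply: famP => i j; rewrite /= /homcx_d_fam.
case: eqP => _; last by rewrite comp0r.
rewrite /homcx_diff /= compBr !compmA cm_d; congr (_ - _).
by rewrite compMzr compmA.
Qed.

Definition homcx_post : abmap (homcx X Y) (homcx X Y') :=
  AbMap homcx_post_B homcx_post_d.

Fact homcx_post_bounded n p : bounded X Y n p -> bounded X Y' n (homcx_post n p).
Proof. by case=> m hm; exists m => i j mi /=; rewrite hm // comp0r. Qed.

Definition stabcx_post : abmap (stabcx X Y) (stabcx X Y') :=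
  quocx_map homcx_post_bounded.

End Post.
End HomComplexMaps.

(* The complex ... -> X_1 -> X_0 -> M -> 0, with M in degree -1. *)
Section Augmentation.
Variables (X : complex C) (M : C) (p : mor (X 0) M).
Hypothesis pd : p ∘ cx_d X 1 0 = 0.

Definition aug_ob (i : int) : C :=
  match i with
  | Posz _ => X i
  | Negz 0 => M
  | Negz _ => zob
  end.

Definition aug_d (i j : int) : mor (aug_ob i) (aug_ob j) :=
  match i, j return mor (aug_ob i) (aug_ob j) with
  | Posz m, Posz k => cx_d X m k
  | Posz 0, Negz 0 => p
  | _, _ => 0
  end.

Fact aug_shape i j : i != j + 1 -> aug_d i j = 0.
Proof. by case: i j => [[|m]|m] [k|[|k]] //= ij; rewrite ?cx_shape. Qed.

Fact aug_d_pos (m k : nat) : aug_d m k = cx_d X m k.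
Proof. by case: m. Qed.

Fact aug_dd i j k : aug_d j k ∘ aug_d i j = 0.
Proof.
case: i => [i|i]; last by rewrite [aug_d (Negz i) j]/= comp0r.
case: j => [j|j]; last by rewrite [aug_d (Negz j) k]/= comp0l.
rewrite aug_d_pos; case: k => [k|k]; first by rewrite aug_d_pos cx_dd.
case: j k => [|j] [|k]; rewrite ?comp0l //=.
have [->|i1] := eqVneq i 1%N; first exact: pd.
by rewrite cx_shape ?comp0r //; apply: contra i1 => /eqP; lia.
Qed.

Definition augment : complex C := Complex aug_shape aug_dd.

End Augmentation.

End Complexes.

Section Resolutions.
Variables (C : extricat) (xi : properclass C).

Definition xi_exact_by (X : complex C) (K : int -> C)
    (g : forall n, mor (K (n + 1)) (X n)) (f : forall n, mor (X n) (K n)) : Prop :=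
  (forall n, exists d : EE (ec_E C) (K n) (K (n + 1)), xi_in xi (g n) (f n) d) /\
  (forall n, cx_d X (n + 1) n = g n ∘ f (n + 1)).

Definition xi_exact (X : complex C) : Prop :=
  exists K g f, @xi_exact_by X K g f.

Record projres (M : C) := ProjRes {
  pr_cx :> complex C;
  pr_neg : forall n : int, n < 0 -> is_zero (pr_cx n);
  pr_proj : forall n : int, 0 <= n -> xi_projective xi (pr_cx n);
  pr_aug : mor (pr_cx 0) M;
  pr_aug_d : pr_aug ∘ cx_d pr_cx 1 0 = 0;
  pr_exact : xi_exact (augment pr_aug_d) }.

(* T is a complete xi-projective resolution, with objects of syzygies K *)
Definition complete_by (T : complex C) (K : int -> C) : Prop :=
  (forall n, xi_projective xi (T n)) /\
  exists (g : forall n, mor (K (n + 1)) (T n)) (f : forall n, mor (T n) (K n)),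
    xi_exact_by g f /\
    forall (n : int) (W : C), xi_projective xi W ->
      short_exact (fun u : mor (K n) W => u ∘ f n)
                  (fun u : mor (T n) W => u ∘ g n).

Definition complete_projres (T : complex C) : Prop :=
  exists K, complete_by T K.

Definition xi_Gprojective (A : C) : Prop :=
  exists (T : complex C) (K : int -> C) (n : int), complete_by T K /\ K n = A.

Inductive Gpdim_le : nat -> C -> Prop :=
| Gpdim0 A : xi_Gprojective A -> Gpdim_le 0 A
| GpdimS n (K G A : C) (x : mor K G) (y : mor G A) (d : EE (ec_E C) A K) :
    xi_in xi x y d -> xi_Gprojective G -> Gpdim_le n K -> Gpdim_le n.+1 A.

Definition finite_Gpdim (M : C) : Prop := exists n, Gpdim_le n M.

Record compres (M : C) (P : projres M) := CompRes {
  cr_cx :> complex C;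
  cr_complete : complete_projres cr_cx;
  cr_nu : chainmap cr_cx P;
  cr_id : exists m : int, forall i, m <= i ->
    exists e : cr_cx i = P i, cr_nu i = eqhom e }.

Definition lift_chain (M M' : C) (P : projres M) (P' : projres M') (f : mor M M') :
    chainmap P P' :=
  choose_or (chainmap0 P P') (fun h => pr_aug P' ∘ h 0 = f ∘ pr_aug P).

End Resolutions.

Section CompleteCohomology.
Variables (C : extricat) (xi : properclass C).
Variable P : forall M : C, projres xi M.

Definition ext (n : int) (M N : C) : zmodType := cohom (homN (P M) N) n.

Definition ext_conn (n : int) (M : C) (t : xitri xi) :
    ext n M (tC t) -> ext (n + 1) M (tA t) :=
  connecting (homN_post (P M) (tx t)) (homN_post (P M) (ty t)) (n := n).

Definition cext (n : int) (M N : C) : zmodType := cohom (stabcx (P M) (P N)) n.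

Definition cext_mapr (n : int) (M N N' : C) (f : mor N N') :
    cext n M N -> cext n M N' :=
  cohom_map (stabcx_post (P M) (lift_chain (P N) (P N') f)) (n := n).

Definition cext_mapl (n : int) (M M' N : C) (f : mor M M') :
    cext n M' N -> cext n M N :=
  cohom_map (stabcx_pre (P N) (lift_chain (P M) (P M') f)) (n := n).

(* The identification of the complete cohomology of M with H^n C(T, N): it is
   the composite of the isomorphisms induced on cohomology by
     C(P_M, P_N) / bounded -> C(T, P_N) / bounded <- C(T, P_N) -> C(T, N),
   where the first map is composition with nu, the second is the projection
   and the third is composition with the augmentation P_N -> N. *)
Definition ident_rel (n : int) (M N : C) (T : compres (P M))
    (z : cext n M N) (w : cohom (homN T N) n) : Prop :=
  exists (v : cohom (homcx T (P N)) n) (phi : homcx T (P N) n),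
    [/\ represents v phi,
        cohom_map (quocx_pi (bounded T (P N))) v =
          cohom_map (stabcx_pre (P N) (cr_nu T)) z
      & represents w (pr_aug (P N) ∘ sub_val phi n 0 : homN T N n)].

Definition comparison (n : int) (M N : C) (T : compres (P M))
    (u : ext n M N) : cext n M N :=
  choose_or 0 (fun z => ident_rel z (cohom_map (homN_pre N (cr_nu T)) u)).

End CompleteCohomology.

Arguments ext {C xi} P n M N.
Arguments ext_conn {C xi} P n M t _.
Arguments cext {C xi} P n M N.
Arguments cext_mapr {C xi} P n M {N N'} f _.
Arguments cext_mapl {C xi} P n {M M'} N f _.
Arguments comparison {C xi P} n {M} N T u.

(* Main.v *)
From HB Require Import structures.
Require Import Defs.
From mathcomp Require Import all_boot all_order all_algebra.
From mathcomp Require Import boolp zify.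

Set Implicit Arguments.
Unset Strict Implicit.
Unset Printing Implicit Defensive.

Import Order.TTheory GRing.Theory Num.Theory.
Local Open Scope ring_scope.
Local Open Scope cat_scope.

(* Write P_N for the chosen resolution of N. The triangle A -> B -> D of xi gives
   a degree-one cocycle theta : P_D -> P_A representing its class in
   xi-ext^1(D, A), and the connecting map on complete cohomology is composition
   with theta, up to sign. It is visibly natural in M, and natural in the
   triangle because theta is unique up to homotopy. The sum P_A + P_D, with its
   differential twisted by theta, is C(Q, -)-exact over B for every projective Q,
   hence homotopy equivalent to P_B; so the long exact sequence is that of the
   degreewise split sequence P_A -> P_A + P_D -> P_D under the functor
   "Hom complex from P_M modulo bounded families".

   For a complete resolution T of M, the map nu induces an isomorphism from the
   families out of P_M to those out of T, modulo bounded ones, and a class of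
   H^n C(T, N) lifts uniquely to H^n of the Hom complex from T to P_N. Under these
   identifications the snake construction on C(T, A) -> C(T, B) -> C(T, D) is
   again composition with theta. *)

(** * Cohomology classes and their representatives *)

Lemma zmod_morN (V W : zmodType) (f : V -> W) x :
  zmod_morphism f -> f (- x) = - f x.
Proof. by move=> fB; rewrite -sub0r fB (zmod_mor0 fB) sub0r. Qed.

Lemma zmod_morD (V W : zmodType) (f : V -> W) x y :
  zmod_morphism f -> f (x + y) = f x + f y.
Proof. by move=> fB; rewrite -[y in LHS]opprK fB (zmod_morN _ fB) opprK. Qed.

Section Representatives.
Variable K : abcx.
Implicit Types n i j : int.

Lemma represents_exists n (u : cohom K n) : exists x, represents u x.
Proof.
by exists (sub_val (quo_repr u)), (quo_repr u); split=> //; apply: quo_reprK.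
Qed.

Lemma represents_cocycle n (u : cohom K n) x :
  represents u x -> ab_d K n (n + 1) x = 0.
Proof. by case=> z [<- _]; exact: (subP z). Qed.

Lemma cocycle_represents n x :
  ab_d K n (n + 1) x = 0 -> exists u : cohom K n, represents u x.
Proof.
move=> dx; pose z := @to_sub _ (cocycle K n) x dx.
by exists (quo_pi _ z), z.
Qed.

(** The preceding degree is a variable [j] subject to [n = j + 1], so that both [n - 1] before [n]
    and [n] before [n + 1] can be used without transporting elements between degrees. *)
Lemma represents0 n j (x : K n) : n = j + 1 ->
  represents (0 : cohom K n) x <-> exists t, x = ab_d K j n t.
Proof.
move=> nj; have -> : j = n - 1 by rewrite nj addrK.
split=> [[z [<- /quo_pi0 [t <-]]]|[t ->]]; first by exists t.
have dx : ab_d K n (n + 1) (ab_d K (n - 1) n t) = 0 by rewrite ab_dd.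
exists (@to_sub _ (cocycle K n) _ dx); split=> //; apply/quo_pi0.
by exists t.
Qed.

Lemma representsB n (u v : cohom K n) x y :
  represents u x -> represents v y -> represents (u - v) (x - y).
Proof.
by case=> z [<- <-] [w [<- <-]]; exists (z - w); split=> //; apply: quo_piB.
Qed.

Lemma represents_eq n j (u v : cohom K n) x y : n = j + 1 ->
    represents u x -> represents v y ->
  u = v <-> exists t, x - y = ab_d K j n t.
Proof.
move=> nj ux vy; split=> [uv|[t xyt]].
  apply/(represents0 _ nj); rewrite -(subrr v) -{1}uv; exact: representsB.
apply/eqP; rewrite -subr_eq0; apply/eqP.
have [z [zE <-]] := representsB ux vy.
apply/quo_pi0; rewrite /= zE; move: t xyt.
have -> : j = n - 1 by rewrite nj addrK.
by move=> t ->; exists t.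
Qed.

Lemma represents_coboundary n j (u : cohom K n) x t :
  represents u x -> represents u (x + ab_d K j n t).
Proof.
move=> ux; have [nj|nj] := eqVneq n (j + 1); last by rewrite ab_shape // addr0.
have [|w wx] := @cocycle_represents n (x + ab_d K j n t).
  by rewrite (zmod_morD _ _ (@ab_dB K _ _)) ab_dd addr0 (represents_cocycle ux).
suff -> : u = w by [].
apply/esym/(represents_eq nj wx ux); exists t; by rewrite addrC addKr.
Qed.

Lemma represents_fun n (u v : cohom K n) x :
  represents u x -> represents v x -> u = v.
Proof.
move=> ux vx; apply/(@represents_eq _ (n - 1) _ _ _ _ _ ux vx).
  by rewrite subrK.
by exists 0; rewrite subrr (zmod_mor0 (@ab_dB K _ _)).
Qed.

End Representatives.

(** * Maps of degree one and degreewise bijections on cohomology *)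

Section DegreeOneMap.
Variables (K L : abcx) (F : forall n, K n -> L (n + 1)).
Hypothesis FB : forall n, zmod_morphism (@F n).
Hypothesis Fd : forall i j x, ab_d L (i + 1) (j + 1) (F x) = F (ab_d K i j x).
Variable n : int.

Fact shift_subproof (z : sub_of (cocycle K n)) :
  cocycle L (n + 1) (F (sub_val z)).
Proof. by rewrite /= Fd (subP z) (zmod_mor0 (@FB _)). Qed.

Definition shift_cocycle (z : sub_of (cocycle K n)) :
    sub_of (cocycle L (n + 1)) := to_sub (shift_subproof z).

Fact shift_cocycleB : zmod_morphism shift_cocycle.
Proof. by move=> x y; apply: val_inj; rewrite /= FB. Qed.

Fact shift_coboundary z :
  coboundary K n z -> coboundary L (n + 1) (shift_cocycle z).
Proof.
case=> t tE; have /= := Fd n t; rewrite tE => <-.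
(* [F t] lies in degree [n - 1 + 1], whereas a primitive is expected in degree [n + 1 - 1]. *)
have -> : n + 1 - 1 = n - 1 + 1 by rewrite addrK subrK.
by exists (F t).
Qed.

Definition cohom_shift : cohom K n -> cohom L (n + 1) :=
  quo_map (coboundary L (n + 1)) shift_cocycle.

Lemma cohom_shiftB : zmod_morphism cohom_shift.
Proof. exact: quo_mapB shift_cocycleB shift_coboundary. Qed.

Lemma cohom_shift_represents u x :
  represents u x -> represents (cohom_shift u) (F x).
Proof.
case=> z [<- <-]; exists (shift_cocycle z); split=> //.
by rewrite /cohom_shift (quo_map_pi shift_cocycleB shift_coboundary).
Qed.

End DegreeOneMap.

Section DegreewiseBijective.
Variables (K L : abcx) (f : abmap K L).
Hypothesis f_inj : forall n x, f n x = 0 -> x = 0.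
Hypothesis f_surj : forall n y, exists x, f n x = y.

(** A primitive of the difference of the images is lifted through [f], and injectivity one degree
    higher brings the equation back. Intended for precomposition with [nu] modulo bounded
    families. *)
Lemma cohom_map_inj n : injective (@cohom_map _ _ f n).
Proof.
move=> u v uv; have [x ux] := represents_exists u.
have [y vy] := represents_exists v.
have nn : n = n - 1 + 1 by rewrite subrK.
have [t] := (represents_eq nn (cohom_map_represents f ux)
  (cohom_map_represents f vy)).1 uv.
have [s <-] := f_surj t; rewrite am_d -am_B => fE.
apply/(represents_eq nn ux vy); exists s; apply/eqP; rewrite -subr_eq0.
by apply/eqP/f_inj; rewrite am_B fE subrr.
Qed.

Lemma cohom_map_surj n (v : cohom L n) : exists u, cohom_map f u = v.
Proof.
have [y vy] := represents_exists v; have [x fx] := f_surj y.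
have [|u ux] := @cocycle_represents K n x.
  by apply: f_inj; rewrite -am_d fx (represents_cocycle vy).
exists u; apply: represents_fun vy; rewrite -fx; exact: cohom_map_represents.
Qed.

End DegreewiseBijective.

(** * The long exact sequence of a short exact sequence of complexes *)

Section LongExactSequence.
Variables (K L Q : abcx) (i : abmap K L) (p : abmap L Q).
Hypothesis ip : forall n, short_exact (i n) (p n).

Let i_inj n : injective (i n). Proof. by case: (ip n). Qed.
Let pP n : exact_at (i n) (p n). Proof. by case: (ip n). Qed.
Let p_surj n w : exists v, p n v = w. Proof. by case: (ip n) => _ _; apply. Qed.
Let pi0 n k : p n (i n k) = 0. Proof. by apply/pP; exists k. Qed.
Let pred1 (n : int) : n = n - 1 + 1. Proof. by rewrite subrK. Qed.

Lemma exact_middle n : exact_at (@cohom_map _ _ i n) (@cohom_map _ _ p n).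
Proof.
move=> v; split=> [pv|[u <-]].
  have [l vl] := represents_exists v; have := cohom_map_represents p vl.
  rewrite pv => /(represents0 _ (pred1 n)) [q plE].
  (* Correcting [l] by the coboundary of a lift of [q] makes its image in [Q] zero, so that it comes
     from [K]. *)
  have [l1 l1E] := p_surj q.
  have [k kE] : exists k, i n k = l - ab_d L (n - 1) n l1.
    by apply/pP; rewrite am_B -am_d l1E -plE subrr.
  have [|u uk] := @cocycle_represents K n k.
    apply: i_inj; rewrite -am_d kE ab_dB (represents_cocycle vl) ab_dd subrr.
    by rewrite (zmod_mor0 (@am_B _ _ _ _)).
  exists u; apply/(represents_eq (pred1 n) (cohom_map_represents i uk) vl).
  exists (- l1); rewrite kE (zmod_morN _ (@ab_dB L _ _)).
  by rewrite addrAC subrr add0r.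
have [k uk] := represents_exists u.
have := cohom_map_represents p (cohom_map_represents i uk); rewrite pi0.
move=> h; apply: (represents_fun h); apply/(represents0 _ (pred1 n)).
by exists 0; rewrite (zmod_mor0 (@ab_dB Q _ _)).
Qed.

Variable conn : forall n, cohom Q n -> cohom K (n + 1).
Hypothesis connP : forall n u, connecting_rel i p u (@conn n u).

(** The snake relation is single-valued. Here [conn] is any map whose values satisfy the relation,
    so the exactness results apply to a connecting map given by a formula. *)
Lemma connecting_rel_fun n (u : cohom Q n) (w : cohom K (n + 1)) :
  connecting_rel i p u w -> conn u = w.
Proof.
case=> l [k [ul ik wk]]; have [l' [k' [ul' ik' wk']]] := connP u.
have [q] := (represents_eq (pred1 n) ul' ul).1 erefl.
have [l1 <-] := p_surj q; rewrite am_d -am_B => plE.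
have [t tE] : exists t, i n t = l' - l - ab_d L (n - 1) n l1.
  by apply/pP; rewrite am_B plE subrr.
apply/(represents_eq (erefl (n + 1)) wk' wk); exists t.
by apply: i_inj; rewrite am_B ik ik' -am_d tE !ab_dB ab_dd subr0.
Qed.

Lemma exact_right n : exact_at (@cohom_map _ _ p n) (@conn n).
Proof.
move=> u; split=> [cu|[v <-]].
  have [l [k [ul ik]]] := connP u; rewrite cu.
  move=> /(represents0 _ (erefl (n + 1))) [t tE].
  have [|v vl] := @cocycle_represents L n (l - i n t).
    by rewrite ab_dB am_d -tE ik subrr.
  exists v; apply: represents_fun ul.
  by have := cohom_map_represents p vl; rewrite am_B pi0 subr0.
have [l vl] := represents_exists v; apply: connecting_rel_fun.
exists l, 0; split; first exact: cohom_map_represents.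
  by rewrite (zmod_mor0 (@am_B _ _ _ _)) (represents_cocycle vl).
by apply/(represents0 _ (erefl (n + 1))); exists 0; rewrite (zmod_mor0 (@ab_dB K _ _)).
Qed.

Lemma exact_left n : exact_at (@conn n) (@cohom_map _ _ i (n + 1)).
Proof.
move=> w; split=> [iw|[u <-]].
  have [k wk] := represents_exists w; have := cohom_map_represents i wk.
  rewrite iw => /(represents0 _ (erefl (n + 1))) [l ik].
  have [|u ul] := @cocycle_represents Q n (p n l).
    by rewrite am_d -ik pi0.
  by exists u; apply: connecting_rel_fun; exists l, k.
have [l [k [ul ik wk]]] := connP u.
apply: (represents_fun (cohom_map_represents i wk)).
by apply/(represents0 _ (erefl (n + 1))); exists l.
Qed.

End LongExactSequence.

(** * Signs and composition of families *)

Lemma to_zero (C : addcat) (A B : C) (f : mor A B) : is_zero B -> f = 0.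
Proof. by move=> z; rewrite -(comp1m f) z comp0l. Qed.

Lemma from_zero (C : addcat) (A B : C) (f : mor A B) : is_zero A -> f = 0.
Proof. by move=> z; rewrite -(compm1 f) z comp0r. Qed.

Lemma mulrz_sgnK (V : zmodType) (n : int) (x : V) : x *~ sgn n *~ sgn n = x.
Proof.
rewrite -mulrzA /sgn -exprMn_comm; last exact: commr_refl.
by rewrite mulrNN mulr1 expr1n mulr1z.
Qed.

Lemma sgnD (m n : int) : sgn (m + n) = sgn m * sgn n.
Proof.
rewrite /sgn -exprD -signr_odd -[in RHS]signr_odd.
by congr (_ ^+ nat_of_bool _); lia.
Qed.

Section Families.
Variable C : addcat.

(* Only the entries with i = j + n of a family of degree n can be nonzero, so
   the composition of families of degrees n and m needs no sum. *)
Definition fam_comp (X Y Z : complex C) (m : int) (q : fam Y Z) (p : fam X Y) :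
  fam X Z := fun i j => q (j + m) j ∘ p i (j + m).

(** Leibniz rule: the two terms on the right that contain the differential of [Y] cancel. *)
Lemma homcx_diff_comp (X Y Z : complex C) (m n k : int) (q : fam Y Z) (p : fam X Y) :
    k = m + n ->
  homcx_diff k (fam_comp m q p) =
  fam_comp (m + 1) (homcx_diff m q) p + fam_comp m q (homcx_diff n p) *~ sgn m.
Proof.
move=> ->; apply: famP => i j.
have famMz (u : fam X Z) z : (u *~ z) i j = u i j *~ z.
  exact: (@zmod_morMz _ _ (fun u : fam X Z => u i j)).
rewrite -[RHS]/(fam_comp (m + 1) (homcx_diff m q) p i j +
  (fam_comp m q (homcx_diff n p) *~ sgn m) i j) famMz.
rewrite /fam_comp /homcx_diff sgnD compBl compBr compMzl !compMzr.
have -> : j + (m + 1) = j + 1 + m by rewrite addrAC addrA.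
have -> : j + 1 + m - 1 = j + m by rewrite addrAC addrK.
have -> : j + m + 1 = j + 1 + m by rewrite addrAC.
rewrite !compmA mulrzBl -!mulrzA [sgn n * _]mulrC.
by rewrite addrA subrK.
Qed.

End Families.

(** * Relative resolutions and the lifting of families along them *)

Section WeakResolutions.
Variables (C : extricat) (xi : properclass C).

(* A projective resolution of N, except that exactness is only required after
   applying C(Q, -) for Q projective, and the terms need not be projective. *)
Record weak_res (Y : complex C) (N : C) (pi : mor (Y 0) N) : Prop := WeakRes {
  wr_neg : forall i : int, i < 0 -> is_zero (Y i);
  wr_aug : pi ∘ cx_d Y 1 0 = 0;
  wr_lift : forall Q, xi_projective xi Q ->
    forall f : mor Q N, exists g, pi ∘ g = f;
  wr_ex0 : forall Q, xi_projective xi Q ->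
    forall u : mor Q (Y 0), pi ∘ u = 0 -> exists v, cx_d Y 1 0 ∘ v = u;
  wr_exS : forall Q, xi_projective xi Q -> forall (k : nat) (u : mor Q (Y k.+1)),
    cx_d Y k.+1 k ∘ u = 0 -> exists v, cx_d Y k.+2 k.+1 ∘ v = u }.

Lemma zero_projective (Q : C) : is_zero Q -> xi_projective xi Q.
Proof.
move=> z A B X x y d xyd; split=> [f g _|f|g].
- by rewrite (from_zero f z) (from_zero g z).
- split=> _; last by rewrite (from_zero f z) comp0r.
  by exists 0; rewrite (from_zero f z) comp0r.
- by exists 0; rewrite (from_zero g z) comp0r.
Qed.

Lemma projres_projective (M : C) (P : projres xi M) i : xi_projective xi (P i).
Proof.
have [i0|i0] := ltP i 0; last exact: pr_proj.
exact: zero_projective (pr_neg P i0).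
Qed.

(** Maps from [Q] are cancelled by [g c], so [f b] kills [u]; then [u] factors through the syzygy
    [K a], and the factor lifts along [f a]. *)
Lemma xi_exact_lift (X : complex C) : xi_exact xi X ->
  forall a b c : int, a = b + 1 -> b = c + 1 ->
  forall (Q : C) (u : mor Q (X b)), xi_projective xi Q ->
  cx_d X b c ∘ u = 0 -> exists v, cx_d X a b ∘ v = u.
Proof.
case=> K [g [f [tri dE]]] a b c -> -> Q u projQ.
have [e1 /projQ [ginj _ _]] := tri c.
have [e2 /projQ [_ gf _]] := tri (c + 1).
have [e3 /projQ [_ _ fsurj]] := tri (c + 1 + 1).
rewrite !dE -compmA => gfu0.
have /gf [u' <-] : f (c + 1) ∘ u = 0 by apply: ginj; rewrite gfu0 comp0r.
by have [v <-] := fsurj u'; exists v; rewrite compmA.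
Qed.

Lemma projres_weak (M : C) (P : projres xi M) : weak_res (pr_aug P).
Proof.
have ex := xi_exact_lift (pr_exact P).
split; [exact: (pr_neg P)|exact: pr_aug_d| | |].
- move=> Q projQ f.
  (* Since [N = M] sits in degree [-1] of the augmented complex, lifting along the augmentation is
     exactness in that degree, where the outgoing differential is zero. *)
  by apply: (ex 0 (- 1) (- 2) _ _ Q f) => //; rewrite comp0l.
- move=> Q projQ u u0.
  exact: (ex 1 0 (- 1) _ _ Q u).
- move=> Q projQ k u u0.
  have := ex k.+2 k.+1 k _ _ Q u projQ; rewrite /= => h.
  by apply: h => //; lia.
Qed.

Section Lifting.
Variables (X Y : complex C) (N : C) (pi : mor (Y 0) N).
Hypothesis projX : forall i, xi_projective xi (X i).
Hypothesis resY : weak_res pi.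
Variable n : int.
Variables (chi : homcx X Y (n + 1)) (f : mor (X n) N).
Hypothesis chi_cocycle : homcx_diff (n + 1) (sub_val chi) = 0.
Hypothesis chi_f :
  pi ∘ sub_val chi (n + 1) 0 = - (f ∘ cx_d X (n + 1) n) *~ sgn n.

(* The family is built column by column: column j + 1 must be mapped by the
   differential of Y to [target] of column j. *)
Let column (j : int) := forall i, mor (X i) (Y j).
Let target j (g : column j) (i : int) : mor (X i) (Y j) :=
  sub_val chi i j + (g (i - 1) ∘ cx_d X i (i - 1)) *~ sgn n.
Let supported j (g : column j) := forall i, i != j + n -> g i = 0.

(** Solvability of the next column: the target has to be a cycle, which is tested by [pi] for column
    0 and by the differential of [Y] afterwards. *)
Let good (k : nat) (g : column k) :=
  supported g /\
  match k return column k -> Prop with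
  | 0 => fun g => forall i, pi ∘ target g i = 0
  | k.+1 => fun g => forall i, cx_d Y k.+1 k ∘ target g i = 0
  end g.

Let step_rel (k : nat) (g : column k) (g' : column k.+1) :=
  forall i, cx_d Y k.+1 k ∘ g' i = target g i.

Let chi_d i (k : nat) :
  cx_d Y k.+1 k ∘ sub_val chi i k.+1 =
  (sub_val chi (i - 1) k ∘ cx_d X i (i - 1)) *~ sgn (n + 1).
Proof.
have := congr1 (fun p : fam X Y => p i k) chi_cocycle.
rewrite /homcx_diff -[RHS]/(0 : mor (X i) (Y k)) => /eqP.
rewrite subr_eq0 => /eqP.
by have -> : Posz k + 1 = Posz k.+1 by lia.
Qed.

Let target_supp j (g : column j) i : supported g -> i != j + n + 1 ->
  target g i = 0.
Proof.
move=> sg ij; rewrite /target (subP chi) ?sg ?comp0l ?mul0rz ?addr0 //.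
  by apply: contra ij => /eqP; lia.
by apply: contra ij => /eqP; lia.
Qed.

Let base : exists g : column 0, good g /\ pi ∘ g n = f.
Proof.
have [g0 g0E] := wr_lift resY (projX n) f.
have [G [Gn Gs]] : exists G : column 0, G n = g0 /\ supported G.
  (* [g0] in index [n], extended by zero and transported along [n = i]. *)
  pose G i : mor (X i) (Y 0) :=
    match pselect (n = i) with
    | left e => match e with erefl => g0 end
    | right _ => 0
    end.
  exists G; rewrite /G; split.
    by case: pselect => // e; rewrite (Prop_irrelevance e erefl).
  by move=> i; rewrite add0r => ni; case: pselect => // e; rewrite e eqxx in ni.
exists G; split; last by rewrite Gn.
split=> // i; have [->|ni] := eqVneq i (n + 1); last first.
  by rewrite target_supp ?comp0r // add0r.
rewrite /target compDr chi_f compMzr compmA mulNrz.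
have -> : n + 1 - 1 = n by rewrite addrK.
by rewrite Gn g0E addNr.
Qed.

Let step (k : nat) (g : column k) : good g ->
  exists g' : column k.+1, good g' /\ step_rel g g'.
Proof.
case=> sg gg.
have ex i : {h : mor (X i) (Y k.+1) |
    (i != Posz k.+1 + n -> h = 0) /\ cx_d Y k.+1 k ∘ h = target g i}.
  apply: cid; have [ik|ik] := eqVneq i (Posz k.+1 + n); last first.
    exists 0; split=> //; rewrite comp0r target_supp //.
    by apply: contra ik => /eqP; lia.
  have [h hE] : exists h : mor (X i) (Y k.+1), cx_d Y k.+1 k ∘ h = target g i.
    case: (k) (g) gg => [|k'] g' g'g.
      exact: (wr_ex0 resY (projX i) (g'g i)).
    exact: (wr_exS resY (projX i) (g'g i)).
  by exists h.
pose g' i := sval (ex i); have g'P i := svalP (ex i).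
exists g'; split; last by move=> i; case: (g'P i).
split=> [i|i]; first by case: (g'P i).
(* The two terms in [chi] cancel because [sgn (n + 1) = - sgn n]; the term in [g] contains two
   consecutive differentials of [X]. *)
rewrite /target compDr chi_d compMzr compmA (g'P _).2 /target.
rewrite compDl mulrzDl compMzl -compmA cx_dd comp0r !mul0rz addr0.
by rewrite sgnS mulrNz addNr.
Qed.

(** Once column [j] is known, the equation prescribes the differential of column [j + 1]. The
    cocycle condition on [chi] makes the prescribed value a cycle, and [chi_f] does so for the first
    column, which lifts [f]. Chain maps, homotopies, the cocycle [theta] and lifts of classes of
    C(T, N) are all obtained from this. *)
Lemma homcx_lift : exists phi : homcx X Y n,
  homcx_diff n (sub_val phi) = sub_val chi /\ pi ∘ sub_val phi n 0 = f.
Proof.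
have [g0 [good0 g0f]] := base.
pose st (k : nat) := {g : column k | good g}.
have next (k : nat) (s : st k) : {s' : st k.+1 | step_rel (sval s) (sval s')}.
  by apply: cid; have [g' [gg' r]] := step (svalP s); exists (exist _ g' gg').
pose fix sq (k : nat) : st k :=
  match k with
  | 0 => exist _ g0 good0
  | k.+1 => sval (next k (sq k))
  end.
have sqS k : step_rel (sval (sq k)) (sval (sq k.+1)) by exact: (svalP (next k (sq k))).
(* Columns of negative index are zero, as [Y] vanishes there. *)
pose phi : fam X Y := fun i j =>
  match j return mor (X i) (Y j) with
  | Posz k => sval (sq k) i
  | Negz _ => 0
  end.
have phi_deg : degree X Y n phi.
  by move=> i [k|k] ij //=; apply: (svalP (sq k)).1.
exists (to_sub phi_deg); split=> //=.
apply: famP => i j.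
case: j => [k|k]; last first.
  by rewrite [LHS](to_zero _ (wr_neg resY _)) // [RHS](to_zero _ (wr_neg resY _)).
rewrite /homcx_diff; have -> : Posz k + 1 = Posz k.+1 by lia.
by rewrite /phi sqS /target addrK.
Qed.

End Lifting.
End WeakResolutions.

(** * Elements of Hom complexes, modulo bounded families *)

Lemma sub_valMz (V : zmodType) (S : subgrp V) (u : sub_of S) (z : int) :
  sub_val (u *~ z) = sub_val u *~ z.
Proof. by apply: (@zmod_morMz _ _ (@sub_val V S)). Qed.

Lemma sub_val_inj (V : zmodType) (S : subgrp V) : injective (@sub_val V S).
Proof. by move=> u v uv; apply: val_inj. Qed.

Section HomComplexElements.
Variable C : addcat.
Implicit Types X Y Z : complex C.

Lemma famMz X Y (p : fam X Y) (z : int) i j : (p *~ z) i j = p i j *~ z.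
Proof. by apply: (@zmod_morMz _ _ (fun p : fam X Y => p i j)). Qed.

Lemma homcx_dS X Y n (p : homcx X Y n) :
  sub_val (ab_d (homcx X Y) n (n + 1) p) = homcx_diff n (sub_val p).
Proof. by rewrite /= /homcx_d_fam eqxx. Qed.

(** Families have independent indices, so the identity must be transported along [i = j]. It serves
    to turn a chain map into a degree-zero cocycle, [fam_of]. *)
Definition idfam X : fam X X := fun i j =>
  match pselect (i = j) with
  | left e => eqhom (congr1 (cx_ob X) e)
  | right _ => 0
  end.

Lemma idfam_diag X i : idfam X i i = idm (X i).
Proof.
by rewrite /idfam; case: pselect => // e; rewrite (Prop_irrelevance e erefl).
Qed.

Lemma idfam_off X i j : i != j -> idfam X i j = 0.
Proof. by rewrite /idfam; case: pselect => // e /eqP. Qed.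

Definition fam_of X Y (h : chainmap X Y) : fam X Y := fun i j => h j ∘ idfam X i j.

Lemma fam_of_degree X Y (h : chainmap X Y) : degree X Y 0 (fam_of h).
Proof. by move=> i j; rewrite addr0 => ij; rewrite /fam_of idfam_off // comp0r. Qed.

Lemma fam_of_cocycle X Y (h : chainmap X Y) : homcx_diff 0 (fam_of h) = 0.
Proof.
apply: famP => i j; rewrite /homcx_diff /fam_of mulr1z -[RHS]/(0 : mor (X i) (Y j)).
have [->|ij] := eqVneq i (j + 1); last first.
  rewrite !idfam_off ?comp0r ?comp0l ?comp0r ?subrr //.
  by apply: contra ij => /eqP <-; rewrite subrK.
rewrite addrK !idfam_diag !compm1 -cm_d; exact: subrr.
Qed.

Lemma fam_of_comp X Y Z (h : chainmap Y Z) (p : fam X Y) :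
  fam_comp 0 (fam_of h) p = fun i j => h j ∘ p i j.
Proof.
by apply: famP => i j; rewrite /fam_comp /fam_of addr0 idfam_diag compm1.
Qed.

Lemma fam_of_diag X Y (h : chainmap X Y) i : fam_of h i i = h i.
Proof. by rewrite /fam_of idfam_diag compm1. Qed.

Fact homcx_comp_degree X Y Z (m n k : int) (q : homcx Y Z m) (p : homcx X Y n) :
  k = m + n -> degree X Z k (fam_comp m (sub_val q) (sub_val p)).
Proof.
move=> -> i j ij; rewrite /fam_comp (subP p) ?comp0r //.
by apply: contra ij => /eqP ->; rewrite addrA.
Qed.

Definition homcx_comp X Y Z (m n k : int) (e : k = m + n) (q : homcx Y Z m)
    (p : homcx X Y n) : homcx X Z k := to_sub (homcx_comp_degree q p e).

Lemma stab_representative X Y n (u : cohom (stabcx X Y) n) :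
  exists p : homcx X Y n, represents u (quo_pi (bounded X Y n) p : stabcx X Y n).
Proof.
have [x ux] := represents_exists u.
by exists (quo_repr (x : quo_of (bounded X Y n))); rewrite quo_reprK.
Qed.

Lemma stab_bounded_d X Y n (u : cohom (stabcx X Y) n) (p : homcx X Y n) :
    represents u (quo_pi (bounded X Y n) p : stabcx X Y n) ->
  exists m : int, forall i j, m <= i -> homcx_diff n (sub_val p) i j = 0.
Proof.
move=> /represents_cocycle /=; rewrite quocx_d_pi => /quo_pi0 [m hm].
by exists m => i j /(hm i j) <-; rewrite homcx_dS.
Qed.

(** By the Leibniz rule the differential of [s p] is [(ds) p] plus a sign times [s (dp)], and [dp]
    is bounded because [p] is a cocycle modulo bounded families. Hence cohomologous families act
    alike on classes. *)
Lemma stab_comp_coboundary X Y Z (m n k : int) (s : homcx Y Z m)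
    (v : cohom (stabcx X Y) n) (p : homcx X Y n)
    (u : cohom (stabcx X Z) k) (r : homcx X Z k) :
    k = m + n + 1 ->
    represents v (quo_pi (bounded X Y n) p : stabcx X Y n) ->
    represents u (quo_pi (bounded X Z k) r : stabcx X Z k) ->
    sub_val r = fam_comp (m + 1) (homcx_diff m (sub_val s)) (sub_val p) ->
  u = 0.
Proof.
move=> kE /stab_bounded_d [b hb] ur rE; apply: (represents_fun ur).
apply/(represents0 _ kE).
pose t := homcx_comp erefl s p; exists (quo_pi (bounded X Z (m + n)) t).
rewrite /= quocx_d_pi; apply/quo_piP; exists b => i j bi.
rewrite -[LHS]/(sub_val r i j - sub_val (ab_d (homcx X Z) (m + n) k t) i j); subst k.
rewrite homcx_dS rE (homcx_diff_comp _ _ (erefl (m + n))).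
set a := fam_comp (m + 1) _ _; set c := fam_comp m _ _.
rewrite -[(a + _) i j]/(a i j + (c *~ sgn m) i j) famMz.
by rewrite /c /fam_comp hb // comp0r mul0rz addr0 subrr.
Qed.

End HomComplexElements.

(** * Composition with a cocycle of degree one *)

Section DegreeOneCocycle.
Variables (C : addcat) (X Y Z : complex C) (theta : homcx Y Z 1).
Hypothesis theta_cocycle : homcx_diff 1 (sub_val theta) = 0.

(* The sign makes composition with theta commute with the differentials, which
   anticommute with it in the Hom complex, and match the snake maps of C(T, -). *)
Definition homcx_shift n (p : homcx X Y n) : homcx X Z (n + 1) :=
  homcx_comp (addrC n 1) theta p *~ sgn (n + 1).

Lemma homcx_shiftE n (p : homcx X Y n) :
  sub_val (homcx_shift p) =
  fam_comp 1 (sub_val theta) (sub_val p) *~ sgn (n + 1).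
Proof. exact: sub_valMz. Qed.

Fact homcx_shiftB n : zmod_morphism (@homcx_shift n).
Proof.
move=> p q; rewrite /homcx_shift -mulrzBl; congr (_ *~ _).
by apply: val_inj; apply: famP => i j; exact: compBr.
Qed.

Fact homcx_shift_d i j (p : homcx X Y i) :
  ab_d (homcx X Z) (i + 1) (j + 1) (homcx_shift p) =
  homcx_shift (ab_d (homcx X Y) i j p).
Proof.
have [->|ij] := eqVneq j (i + 1); last first.
  rewrite [in RHS]ab_shape // (zmod_mor0 (@homcx_shiftB j)) ab_shape //.
  by apply: contra ij => /eqP /addIr ->.
apply: sub_val_inj; rewrite homcx_dS !homcx_shiftE homcx_dS.
rewrite (zmod_morMz _ _ (@homcx_diffB _ _ _ _)).
rewrite (@homcx_diff_comp _ _ _ _ 1 i) ?theta_cocycle; last by rewrite addrC.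
have -> : fam_comp (1 + 1) (0 : fam Y Z) (sub_val p) = 0.
  by apply: famP => a b; exact: comp0l.
by rewrite add0r -mulrzA [sgn (i + 1 + 1)]sgnS mulN1r.
Qed.

Fact homcx_shift_bounded n (p : homcx X Y n) :
  bounded X Y n p -> bounded X Z (n + 1) (homcx_shift p).
Proof.
case=> m hm; exists m => i j mi; rewrite homcx_shiftE famMz /fam_comp hm //.
by rewrite comp0r mul0rz.
Qed.

Definition stab_shift n : stabcx X Y n -> stabcx X Z (n + 1) :=
  quo_map (bounded X Z (n + 1)) (@homcx_shift n).

Fact stab_shiftB n : zmod_morphism (@stab_shift n).
Proof. exact: quo_mapB (@homcx_shiftB n) (@homcx_shift_bounded n). Qed.

Lemma stab_shift_pi n (p : homcx X Y n) :
  stab_shift (quo_pi (bounded X Y n) p) =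
  quo_pi (bounded X Z (n + 1)) (homcx_shift p).
Proof. exact: (quo_map_pi (@homcx_shiftB n) (@homcx_shift_bounded n)). Qed.

Fact stab_shift_d i j (x : stabcx X Y i) :
  ab_d (stabcx X Z) (i + 1) (j + 1) (stab_shift x) =
  stab_shift (ab_d (stabcx X Y) i j x).
Proof.
rewrite -(quo_reprK (x : quo_of (bounded X Y i))) stab_shift_pi /= !quocx_d_pi.
by rewrite homcx_shift_d stab_shift_pi.
Qed.

Definition stab_conn n : cohom (stabcx X Y) n -> cohom (stabcx X Z) (n + 1) :=
  cohom_shift stab_shiftB stab_shift_d (n := n).

Lemma stab_connB n : zmod_morphism (@stab_conn n).
Proof. exact: cohom_shiftB. Qed.

Lemma stab_conn_represents n (u : cohom (stabcx X Y) n) (p : homcx X Y n) :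
    represents u (quo_pi (bounded X Y n) p : stabcx X Y n) ->
  represents (stab_conn u)
    (quo_pi (bounded X Z (n + 1)) (homcx_shift p) : stabcx X Z (n + 1)).
Proof.
move=> up; rewrite -stab_shift_pi; exact: cohom_shift_represents up.
Qed.

End DegreeOneCocycle.

(** * The action of chain maps on stable cohomology *)

Lemma choose_orP (T : Type) (x0 : T) (P : T -> Prop) :
  (exists x, P x) -> P (choose_or x0 P).
Proof. by rewrite /choose_or; case: pselect => // h _; exact: (projT2 (cid h)). Qed.

Section ChainMaps.
Variable C : addcat.
Implicit Types X Y Z W : complex C.

Fact chain_id_subproof X i j : cx_d X i j ∘ idm (X i) = idm (X j) ∘ cx_d X i j.
Proof. by rewrite compm1 comp1m. Qed.

Definition chain_id X : chainmap X X := ChainMap (@chain_id_subproof X).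

Fact chain_comp_subproof X Y Z (g : chainmap Y Z) (f : chainmap X Y) i j :
  cx_d Z i j ∘ (g i ∘ f i) = g j ∘ f j ∘ cx_d X i j.
Proof. by rewrite compmA cm_d -!compmA cm_d. Qed.

Definition chain_comp X Y Z (g : chainmap Y Z) (f : chainmap X Y) :
  chainmap X Z := ChainMap (chain_comp_subproof g f).

Lemma stab_post_pi W X Y (h : chainmap X Y) n (p : homcx W X n) :
  stabcx_post W h n (quo_pi (bounded W X n) p) =
  quo_pi (bounded W Y n) (homcx_post W h n p).
Proof. by apply: quo_map_pi; [exact: am_B|exact: homcx_post_bounded]. Qed.

Lemma stab_pre_pi W W' X (h : chainmap W' W) n (p : homcx W X n) :
  stabcx_pre X h n (quo_pi (bounded W X n) p) =
  quo_pi (bounded W' X n) (homcx_pre X h n p).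
Proof. by apply: quo_map_pi; [exact: am_B|exact: homcx_pre_bounded]. Qed.

Lemma stab_post_represents W X Y (h : chainmap X Y) n
    (u : cohom (stabcx W X) n) (p : homcx W X n) :
    represents u (quo_pi (bounded W X n) p : stabcx W X n) ->
  represents (cohom_map (stabcx_post W h) u)
    (quo_pi (bounded W Y n) (homcx_post W h n p) : stabcx W Y n).
Proof.
by move/(cohom_map_represents (stabcx_post W h)); rewrite stab_post_pi.
Qed.

Lemma stab_pre_represents W W' X (h : chainmap W' W) n
    (u : cohom (stabcx W X) n) (p : homcx W X n) :
    represents u (quo_pi (bounded W X n) p : stabcx W X n) ->
  represents (cohom_map (stabcx_pre X h) u)
    (quo_pi (bounded W' X n) (homcx_pre X h n p) : stabcx W' X n).
Proof.
by move/(cohom_map_represents (stabcx_pre X h)); rewrite stab_pre_pi.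
Qed.

Lemma stab_represents_fun X Y n (u v : cohom (stabcx X Y) n) (p q : homcx X Y n) :
    represents u (quo_pi (bounded X Y n) p : stabcx X Y n) ->
    represents v (quo_pi (bounded X Y n) q : stabcx X Y n) ->
  sub_val p = sub_val q -> u = v.
Proof.
by move=> up vq /sub_val_inj pq; rewrite pq in up; apply: represents_fun up vq.
Qed.

Lemma stab_representsB X Y n (u v : cohom (stabcx X Y) n) (p q : homcx X Y n) :
    represents u (quo_pi (bounded X Y n) p : stabcx X Y n) ->
    represents v (quo_pi (bounded X Y n) q : stabcx X Y n) ->
  represents (u - v) (quo_pi (bounded X Y n) (p - q) : stabcx X Y n).
Proof. by move=> up vq; rewrite quo_piB; apply: representsB up vq. Qed.

Lemma stab_post_id W X n (u : cohom (stabcx W X) n) :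
  cohom_map (stabcx_post W (chain_id X)) u = u.
Proof.
have [p up] := stab_representative u.
apply: (stab_represents_fun (stab_post_represents (chain_id X) up) up).
by apply: famP => i j; exact: comp1m.
Qed.

Lemma stab_post_comp W X Y Z (g : chainmap Y Z) (f : chainmap X Y) n
    (u : cohom (stabcx W X) n) :
  cohom_map (stabcx_post W (chain_comp g f)) u =
  cohom_map (stabcx_post W g) (cohom_map (stabcx_post W f) u).
Proof.
have [p up] := stab_representative u.
have h1 := stab_post_represents (chain_comp g f) up.
have h2 := stab_post_represents g (stab_post_represents f up).
apply: (stab_represents_fun h1 h2); apply: famP => i j.
by rewrite /= compmA.
Qed.

(** Composing with [theta] on the left and with [h] on the right commute by associativity. This
    serves both for naturality in [M] and for the passage from [P M] to a complete resolution. *)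
Lemma stab_conn_pre W W' Y Z (theta : homcx Y Z 1)
    (dtheta : homcx_diff 1 (sub_val theta) = 0) (h : chainmap W' W) n
    (u : cohom (stabcx W Y) n) :
  stab_conn dtheta (cohom_map (stabcx_pre Y h) u) =
  cohom_map (stabcx_pre Z h) (stab_conn dtheta u).
Proof.
have [p up] := stab_representative u.
have h1 := stab_pre_represents h (stab_conn_represents dtheta up).
have h2 := stab_conn_represents dtheta (stab_pre_represents h up).
apply: (stab_represents_fun h2 h1); rewrite homcx_shiftE.
apply: famP => i j; rewrite famMz -[RHS]/(sub_val (homcx_shift theta p) i j ∘ h i).
by rewrite homcx_shiftE famMz compMzl; congr (_ *~ _); exact: compmA.
Qed.

End ChainMaps.

(** * Existence and uniqueness of lifts up to homotopy *)

Section Uniqueness.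
Variables (C : extricat) (xi : properclass C).
Variables (X Y : complex C) (N : C) (pi : mor (Y 0) N).
Hypothesis projX : forall i, xi_projective xi (X i).
Hypothesis resY : weak_res xi pi.

(** The case [n = 0], [chi = 0] of [homcx_lift]: the diagonal of a cocycle of degree zero is a chain
    map. *)
Lemma chain_lift (f : mor (X 0) N) : f ∘ cx_d X 1 0 = 0 ->
  exists h : chainmap X Y, pi ∘ h 0 = f.
Proof.
move=> fd; have [||phi [dphi <-]] := @homcx_lift C xi X Y N pi projX resY 0 0 f.
- exact: (zmod_mor0 (@homcx_diffB _ _ _ _)).
- by rewrite [RHS]mulr1z fd oppr0 [LHS]comp0r.
have cm i j : cx_d Y i j ∘ sub_val phi i i = sub_val phi j j ∘ cx_d X i j.
  have [->|ij] := eqVneq i (j + 1); last by rewrite !cx_shape // comp0l comp0r.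
  have := congr1 (fun p : fam X Y => p (j + 1) j) dphi.
  rewrite /homcx_diff addrK mulr1z => /eqP.
  by rewrite -[X in _ == X]/(0 : mor (X (j + 1)) (Y j)) subr_eq0 => /eqP.
by exists (ChainMap cm).
Qed.

(** Composition with [pi] is injective on cohomology: a primitive [w] of the augmented cocycle, up
    to sign, is taken as the prescribed value in [homcx_lift]. *)
Lemma homcx_null (n : int) (chi : homcx X Y (n + 1)) (w : mor (X n) N) :
    homcx_diff (n + 1) (sub_val chi) = 0 ->
    pi ∘ sub_val chi (n + 1) 0 = w ∘ cx_d X (n + 1) n ->
  exists s : homcx X Y n, homcx_diff n (sub_val s) = sub_val chi.
Proof.
move=> dchi chiw.
have [||phi [dphi _]] := @homcx_lift C xi X Y N pi projX resY n chi
  (- (w *~ sgn n)) => //; last by exists phi.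
by rewrite chiw compNl opprK compMzl mulrz_sgnK.
Qed.

Lemma chain_homotopy (h h' : chainmap X Y) : pi ∘ h 0 = pi ∘ h' 0 ->
  exists s : homcx X Y (- 1), homcx_diff (- 1) (sub_val s) = fam_of h - fam_of h'.
Proof.
move=> hh'.
have deg : degree X Y (- 1 + 1) (fam_of h - fam_of h').
  by apply: sg_B; apply: fam_of_degree.
apply: (@homcx_null (- 1) (to_sub deg) 0) => /=.
  by rewrite (@homcx_diffB _ X Y 0) !fam_of_cocycle subrr.
rewrite -[X in _ ∘ X]/(fam_of h 0 0 - fam_of h' 0 0) !fam_of_diag compBr hh'.
by rewrite [RHS]comp0l; exact: subrr.
Qed.

(** The difference of two lifts is the differential of a homotopy [s], so [stab_comp_coboundary]
    applies. The induced map is thus determined by the map on augmentations. *)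
Lemma stab_post_unique (W : complex C) (h h' : chainmap X Y) n
    (u : cohom (stabcx W X) n) : pi ∘ h 0 = pi ∘ h' 0 ->
  cohom_map (stabcx_post W h) u = cohom_map (stabcx_post W h') u.
Proof.
move=> /chain_homotopy [s ds]; have [p up] := stab_representative u.
have hr := stab_representsB (stab_post_represents h up) (stab_post_represents h' up).
apply/eqP; rewrite -subr_eq0; apply/eqP.
apply: (stab_comp_coboundary (s := s) _ up hr); first by rewrite addrAC addNr add0r.
rewrite ds; apply: famP => i j.
transitivity ((fam_comp 0 (fam_of h) (sub_val p) -
  fam_comp 0 (fam_of h') (sub_val p)) i j); first by rewrite !fam_of_comp.
by rewrite -[LHS]compBl.
Qed.

End Uniqueness.

Lemma lift_chainP (C : extricat) (xi : properclass C) (M M' : C)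
    (P : projres xi M) (P' : projres xi M') (f : mor M M') :
  pr_aug P' ∘ lift_chain P P' f 0 = f ∘ pr_aug P.
Proof.
apply: (@choose_orP _ _ (fun h : chainmap P P' => pr_aug P' ∘ h 0 = f ∘ pr_aug P)).
apply: (chain_lift (xi := xi)); [exact: projres_projective|exact: projres_weak|].
by rewrite -compmA pr_aug_d comp0r.
Qed.

(** * Matrix calculus for biproducts *)

Section Biproducts.
Variable C : addcat.

Lemma bip_eq_to (Q A B : C) (u v : mor Q (A ⊕ B)) :
  pr1 A B ∘ u = pr1 A B ∘ v -> pr2 A B ∘ u = pr2 A B ∘ v -> u = v.
Proof.
move=> e1 e2; rewrite -(comp1m u) -(comp1m v) -bip_sum !compDl -!compmA.
by rewrite e1 e2.
Qed.

Lemma bip_eq_from (Q A B : C) (u v : mor (A ⊕ B) Q) :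
  u ∘ in1 A B = v ∘ in1 A B -> u ∘ in2 A B = v ∘ in2 A B -> u = v.
Proof.
move=> e1 e2; rewrite -(compm1 u) -(compm1 v) -bip_sum !compDr !compmA.
by rewrite e1 e2.
Qed.

Definition copair (Q A B : C) (a : mor A Q) (b : mor B Q) : mor (A ⊕ B) Q :=
  a ∘ pr1 A B + b ∘ pr2 A B.

Definition bpair (Q A B : C) (a : mor Q A) (b : mor Q B) : mor Q (A ⊕ B) :=
  in1 A B ∘ a + in2 A B ∘ b.

Lemma copair_in1 (Q A B : C) (a : mor A Q) (b : mor B Q) :
  copair a b ∘ in1 A B = a.
Proof. by rewrite compDl -!compmA pr1_in1 pr2_in1 comp0r addr0 compm1. Qed.

Lemma copair_in2 (Q A B : C) (a : mor A Q) (b : mor B Q) :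
  copair a b ∘ in2 A B = b.
Proof. by rewrite compDl -!compmA pr1_in2 pr2_in2 comp0r add0r compm1. Qed.

Lemma pr1_bpair (Q A B : C) (a : mor Q A) (b : mor Q B) :
  pr1 A B ∘ bpair a b = a.
Proof. by rewrite compDr !compmA pr1_in1 pr1_in2 comp0l addr0 comp1m. Qed.

Lemma pr2_bpair (Q A B : C) (a : mor Q A) (b : mor Q B) :
  pr2 A B ∘ bpair a b = b.
Proof. by rewrite compDr !compmA pr2_in1 pr2_in2 comp0l add0r comp1m. Qed.

Lemma comp_bpair (Q R A B : C) (a : mor Q A) (b : mor Q B) (f : mor R Q) :
  bpair a b ∘ f = bpair (a ∘ f) (b ∘ f).
Proof. by rewrite compDl -!compmA. Qed.

Lemma copair_bpair (Q R A B : C) (c : mor A R) (d : mor B R) (a : mor Q A)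
    (b : mor Q B) :
  copair c d ∘ bpair a b = c ∘ a + d ∘ b.
Proof. by rewrite compDl -!compmA pr1_bpair pr2_bpair. Qed.

Lemma bpair_pr (Q A B : C) (u : mor Q (A ⊕ B)) :
  bpair (pr1 A B ∘ u) (pr2 A B ∘ u) = u.
Proof. by apply: bip_eq_to; rewrite ?pr1_bpair ?pr2_bpair. Qed.

Lemma bip_zero (A B : C) : is_zero A -> is_zero B -> is_zero (A ⊕ B).
Proof.
move=> zA zB; apply: bip_eq_to.
  by rewrite (to_zero (_ ∘ _) zA) comp0r.
by rewrite (to_zero (_ ∘ _) zB) comp0r.
Qed.

End Biproducts.

Lemma bip_projective (C : extricat) (xi : properclass C) (P Q : C) :
  xi_projective xi P -> xi_projective xi Q -> xi_projective xi (P ⊕ Q).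
Proof.
move=> projP projQ A B X x y d xyd.
have [xP yP sP] := projP _ _ _ _ _ _ xyd.
have [xQ yQ sQ] := projQ _ _ _ _ _ _ xyd.
split=> [f g /= fg|f|g].
- by apply: bip_eq_from; [apply: xP|apply: xQ]; rewrite !compmA fg.
- split=> [yf|[u <-]].
    have [|u1 u1E] := (yP (f ∘ in1 P Q)).1; first by rewrite compmA yf comp0l.
    have [|u2 u2E] := (yQ (f ∘ in2 P Q)).1; first by rewrite compmA yf comp0l.
    exists (copair u1 u2); apply: bip_eq_from.
      by rewrite -compmA copair_in1.
    by rewrite -compmA copair_in2.
  apply: bip_eq_from; rewrite comp0l -!compmA.
    by apply/yP; eexists.
  by apply/yQ; eexists.
- have [v1 v1E] := sP (g ∘ in1 P Q); have [v2 v2E] := sQ (g ∘ in2 P Q).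
  exists (copair v1 v2); apply: bip_eq_from.
    by rewrite -compmA copair_in1.
  by rewrite -compmA copair_in2.
Qed.

(** * The sum of two complexes twisted by a cocycle *)

Section TwistedSum.
Variables (C : addcat) (X Z : complex C) (theta : homcx Z X 1).
Hypothesis theta_cocycle : homcx_diff 1 (sub_val theta) = 0.

Let th i j : mor (Z i) (X j) := sub_val theta i j.

Lemma cocycle1P i j k : cx_d X j k ∘ th i j = - (th j k ∘ cx_d Z i j).
Proof.
apply/eqP; rewrite -addr_eq0; apply/eqP; rewrite /th.
have [->|jk] := eqVneq j (k + 1); last first.
  by rewrite cx_shape // comp0l (subP theta) // comp0l addr0.
have [->|ij] := eqVneq i (k + 1 + 1); last first.
  by rewrite [cx_d Z _ _]cx_shape // comp0r (subP theta) // comp0r addr0.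
have := congr1 (fun p : fam Z X => p (k + 1 + 1) k) theta_cocycle.
rewrite /homcx_diff addrK mulrN1z opprK => ->.
by [].
Qed.

(** A triangular matrix with [theta] in the corner: up to signs, the mapping cone of [theta]
    regarded as a chain map to [X] from a shift of [Z]. *)
Definition twist_d i j : mor (X i ⊕ Z i) (X j ⊕ Z j) :=
  bpair (copair (cx_d X i j) (th i j)) (cx_d Z i j ∘ pr2 (X i) (Z i)).

Fact twist_shape i j : i != j + 1 -> twist_d i j = 0.
Proof.
move=> ij; rewrite /twist_d !cx_shape // /th (subP theta) // /copair /bpair.
by rewrite !(comp0l, comp0r, addr0).
Qed.

Fact twist_dd i j k : twist_d j k ∘ twist_d i j = 0.
Proof.
rewrite /twist_d comp_bpair copair_bpair -[cx_d Z j k ∘ _ ∘ _]compmA pr2_bpair.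
rewrite [cx_d Z j k ∘ _]compmA cx_dd comp0l /copair compDr !compmA.
rewrite cx_dd comp0l add0r cocycle1P compNl addNr.
by rewrite /bpair !comp0r addr0.
Qed.

Definition twist : complex C := Complex twist_shape twist_dd.

Fact twist_in_d i j :
  cx_d twist i j ∘ in1 (X i) (Z i) = in1 (X j) (Z j) ∘ cx_d X i j.
Proof.
by rewrite comp_bpair copair_in1 -compmA pr2_in1 comp0r /bpair comp0r addr0.
Qed.

Definition twist_in : chainmap X twist :=
  @ChainMap C X twist (fun i => in1 (X i) (Z i)) twist_in_d.

Fact twist_pr_d i j :
  cx_d Z i j ∘ pr2 (X i) (Z i) = pr2 (X j) (Z j) ∘ cx_d twist i j.
Proof. by rewrite pr2_bpair. Qed.

Definition twist_pr : chainmap twist Z :=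
  @ChainMap C twist Z (fun i => pr2 (X i) (Z i)) twist_pr_d.

Section Exactness.
Variable W : complex C.

(** The splittings [pr1] and [in2] of the twisted sum need not be chain maps, so postcomposition is
    stated for arbitrary families of morphisms. *)
Let post (Y Y' : complex C) (h : forall j, mor (Y j) (Y' j)) n
    (p : homcx W Y n) : degree W Y' n (fun i j => h j ∘ sub_val p i j).
Proof. by move=> i j ij; rewrite (subP p) // comp0r. Qed.

Lemma twist_short_exact n :
  short_exact (stabcx_post W twist_in n) (stabcx_post W twist_pr n).
Proof.
split.
- move=> u v; rewrite -(quo_reprK (u : quo_of (bounded W X n))).
  rewrite -(quo_reprK (v : quo_of (bounded W X n))).
  rewrite !stab_post_pi => /quo_piP [m hm]; apply/quo_piP; exists m => i j /(hm i j).
  move: (quo_repr _) (quo_repr _) => q p.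
  rewrite -[X in X = 0 -> _]/
    (in1 (X j) (Z j) ∘ sub_val p i j - in1 (X j) (Z j) ∘ sub_val q i j).
  move=> /(congr1 (compm (pr1 (X j) (Z j)))).
  by rewrite comp0r compBr !compmA pr1_in1 !comp1m.
- move=> v; rewrite -(quo_reprK (v : quo_of (bounded W twist n))).
  move: (quo_repr _) => p; split=> [|[u <-]].
    rewrite stab_post_pi => /quo_pi0 [m hm].
    exists (quo_pi _ (to_sub (@post twist X (fun j => pr1 (X j) (Z j)) n p))).
    rewrite stab_post_pi; apply/quo_piP; exists m => i j /(hm i j) /= pr0.
    rewrite -[LHS]/
      (in1 (X j) (Z j) ∘ (pr1 (X j) (Z j) ∘ sub_val p i j) - sub_val p i j).
    rewrite -[X in _ - X]bpair_pr pr0 /bpair comp0r addr0; exact: subrr.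
  rewrite -(quo_reprK (u : quo_of (bounded W X n))); move: (quo_repr _) => q.
  rewrite !stab_post_pi; apply/quo_pi0; exists 0 => i j _ /=.
  by rewrite compmA pr2_in1 comp0l.
- move=> v; rewrite -(quo_reprK (v : quo_of (bounded W Z n))).
  move: (quo_repr _) => p.
  exists (quo_pi _ (to_sub (@post Z twist (fun j => in2 (X j) (Z j)) n p))).
  rewrite stab_post_pi; congr quo_pi; apply: sub_val_inj; apply: famP => i j /=.
  by rewrite compmA pr2_in2 comp1m.
Qed.

(** Lift [p] through [in2]: the differential of the lift is [in1 (theta p) + in2 (dp)], and [dp] is
    bounded. The factor [sgn (n + 1)] undoes the sign built into [homcx_shift]. *)
Lemma twist_connecting n (u : cohom (stabcx W Z) n) :
  connecting_rel (stabcx_post W twist_in) (stabcx_post W twist_pr) u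
    (stab_conn theta_cocycle u *~ sgn (n + 1)).
Proof.
have [p up] := stab_representative u.
pose l := to_sub (@post Z twist (fun j => in2 (X j) (Z j)) n p).
have [m hm] := stab_bounded_d up.
exists (quo_pi (bounded W twist n) l).
exists (quo_pi (bounded W X (n + 1)) (homcx_comp (addrC n 1) theta p)); split.
- rewrite stab_post_pi; have <- : p = homcx_post W twist_pr n l; last by [].
  apply: sub_val_inj; apply: famP => i j /=.
  by rewrite compmA pr2_in2 comp1m.
- rewrite stab_post_pi /= quocx_d_pi; apply/quo_piP; exists m => i j mi.
  rewrite -[LHS]/(in1 (X j) (Z j) ∘ (th (j + 1) j ∘ sub_val p i (j + 1)) -
    sub_val (ab_d (homcx W twist) n (n + 1) l) i j) homcx_dS.
  have := hm i j mi; rewrite /homcx_diff /= => /eqP; rewrite subr_eq0 => /eqP pE.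
  rewrite [_ ∘ (in2 _ _ ∘ _)]compmA comp_bpair copair_in2.
  rewrite -[cx_d Z _ _ ∘ _ ∘ _]compmA pr2_in2 compm1.
  rewrite comp_bpair pE /bpair -compmA compMzr.
  by rewrite -addrA subrr addr0 subrr.
- have := stab_conn_represents theta_cocycle up.
  rewrite /homcx_shift; move: (stab_conn _ _) (homcx_comp _ _ _) => w q.
  case=> z [zE <-]; exists (z *~ sgn (n + 1)); split.
    rewrite sub_valMz zE -(zmod_morMz _ _ (@quo_piB _ _)).
    by rewrite mulrz_sgnK.
  by rewrite (zmod_morMz _ _ (@quo_piB _ _)).
Qed.

End Exactness.
End TwistedSum.

(** * The twisted sum as a resolution of the middle term *)

Section Horseshoe.
Variables (C : extricat) (xi : properclass C).
Variables (A B D : C) (x : mor A B) (y : mor B D) (e : EE (ec_E C) D A).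
Hypothesis xye : xi_in xi x y e.
Variables (X Z : complex C) (piX : mor (X 0) A) (piZ : mor (Z 0) D).
Hypothesis resX : weak_res xi piX.
Hypothesis resZ : weak_res xi piZ.
Hypothesis projX : forall i, xi_projective xi (X i).
Hypothesis projZ : forall i, xi_projective xi (Z i).

(* The cocycle piX theta_{1,0} : Z_1 -> A represents, up to sign, the class of the
   triangle in xi-ext^1(D, A). *)
Definition classifies (theta : homcx Z X 1) (g : mor (Z 0) B) : Prop :=
  y ∘ g = piZ /\ x ∘ (piX ∘ sub_val theta 1 0) = - (g ∘ cx_d Z 1 0).

(** Lift [piZ] to [g] along [y]; then [y] kills [g d], so [- g d = x f] for some [f]. As [x] is
    injective on maps from [Z 2], [f] is a cocycle of C(Z, A), and it lifts to [theta]. *)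
Lemma classifies_exists : exists2 theta : homcx Z X 1,
  homcx_diff 1 (sub_val theta) = 0 & exists g, classifies theta g.
Proof.
have [g gE] : exists g, y ∘ g = piZ by have [_ _] := projZ 0 xye; apply.
have [_ xex _] := projZ 1 xye; have [xinj _ _] := projZ 2 xye.
have [|f xf] := (xex (- (g ∘ cx_d Z 1 0))).1.
  by rewrite compNr compmA gE (wr_aug resZ) oppr0.
have [||theta [dtheta tf]] := @homcx_lift C xi Z X A piX projZ resX 1 0 f.
- exact: (zmod_mor0 (@homcx_diffB _ _ _ _)).
- have -> : f ∘ cx_d Z (1 + 1) 1 = 0.
    by apply: xinj; rewrite compmA xf compNl -compmA cx_dd comp0r oppr0 comp0r.
  by rewrite oppr0 mul0rz [LHS]comp0r.
by exists theta => //; exists g; split=> //; rewrite tf.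
Qed.

Variables (theta : homcx Z X 1) (g : mor (Z 0) B).
Hypothesis dtheta : homcx_diff 1 (sub_val theta) = 0.
Hypothesis tg : classifies theta g.

Let gE : y ∘ g = piZ. Proof. by case: tg. Qed.
Let thetaE : x ∘ (piX ∘ sub_val theta 1 0) = - (g ∘ cx_d Z 1 0).
Proof. by case: tg. Qed.

Let H := twist dtheta.

Definition twist_aug : mor (H 0) B := copair (x ∘ piX) g.

Lemma twist_projective i : xi_projective xi (H i).
Proof. exact: bip_projective. Qed.

Lemma aug_twist : y ∘ twist_aug = piZ ∘ twist_pr dtheta 0.
Proof.
have [_ xex _] := projX 0 xye.
have yx : y ∘ (x ∘ piX) = 0 by apply/xex; exists piX.
apply: bip_eq_from; rewrite -!compmA ?copair_in1 ?copair_in2.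
  by rewrite yx pr2_in1 comp0r.
by rewrite gE pr2_in2 compm1.
Qed.

(** Horseshoe argument on maps from a projective [Q]: the [Z]-component is solved first, and the
    remainder, corrected by [g] or [theta], is solved in [X]. The sign in [classifies] makes the
    augmentation vanish on boundaries. *)
Lemma twist_weak : weak_res xi twist_aug.
Proof.
split.
- by move=> i i0; apply: bip_zero; [exact: (wr_neg resX)|exact: (wr_neg resZ)].
- rewrite /twist_aug [LHS]copair_bpair /copair compDr !compmA.
  rewrite -[x ∘ piX ∘ cx_d X 1 0]compmA (wr_aug resX) comp0r comp0l add0r.
  by rewrite -[x ∘ piX ∘ _]compmA thetaE compNl addNr.
- move=> Q projQ f; have [_ xex _] := projQ _ _ _ _ _ _ xye.
  have [c cE] := wr_lift resZ projQ (y ∘ f).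
  have [|a' a'E] := (xex (f - g ∘ c)).1.
    by rewrite compBr compmA gE cE subrr.
  have [a aE] := wr_lift resX projQ a'.
  by exists (bpair a c); rewrite [LHS]copair_bpair -compmA aE a'E subrK.
- move=> Q projQ u; rewrite -[u]bpair_pr.
  move: (pr1 _ _ ∘ u) (pr2 _ _ ∘ u) => a c {u}.
  rewrite [twist_aug ∘ _]copair_bpair => acE.
  have [xinj xex _] := projQ _ _ _ _ _ _ xye.
  have [|c' c'E] := wr_ex0 resZ projQ (u := c).
    have := congr1 (compm y) acE; rewrite comp0r compDr [y ∘ (g ∘ c)]compmA gE.
    have -> : y ∘ (x ∘ piX ∘ a) = 0.
      by apply/xex; exists (piX ∘ a); rewrite compmA.
    by rewrite add0r.
  have [|a' a'E] := wr_ex0 resX projQ (u := a - sub_val theta 1 0 ∘ c').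
    apply: xinj; rewrite comp0r compBr !compBr !compmA.
    rewrite -[x ∘ piX ∘ sub_val theta 1 0]compmA thetaE compNl opprK.
    rewrite -[g ∘ _ ∘ c']compmA c'E; exact: acE.
  exists (bpair a' c'); rewrite [LHS]comp_bpair copair_bpair -compmA pr2_bpair.
  by rewrite a'E c'E subrK.
- move=> Q projQ k u; rewrite -[u]bpair_pr.
  move: (pr1 _ _ ∘ u) (pr2 _ _ ∘ u) => a c {u}.
  rewrite [cx_d H _ _ ∘ _]comp_bpair copair_bpair -compmA pr2_bpair => acE.
  have := congr1 (compm (pr2 _ _)) acE; rewrite pr2_bpair comp0r.
  move=> /(wr_exS resZ projQ) [c' c'E].
  have := congr1 (compm (pr1 _ _)) acE; rewrite pr1_bpair comp0r => ac0.
  have [|a' a'E] := wr_exS resX projQ (u := a - sub_val theta k.+2 k.+1 ∘ c').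
    rewrite compBr compmA (cocycle1P dtheta) compNl opprK -compmA c'E.
    exact: ac0.
  exists (bpair a' c'); rewrite [LHS]comp_bpair copair_bpair -compmA pr2_bpair.
  by rewrite a'E c'E subrK.
Qed.

Variables (Y : complex C) (piY : mor (Y 0) B).
Hypothesis resY : weak_res xi piY.
Hypothesis projY : forall i, xi_projective xi (Y i).
Variables (hx : chainmap X Y) (hy : chainmap Y Z).
Hypothesis hxE : piY ∘ hx 0 = x ∘ piX.
Hypothesis hyE : piZ ∘ hy 0 = y ∘ piY.

Lemma stab_long_exact (W : complex C) n :
  [/\ exact_at (cohom_map (stabcx_post W hx) (n := n))
        (cohom_map (stabcx_post W hy) (n := n)),
      exact_at (cohom_map (stabcx_post W hy) (n := n))
        (@stab_conn C W Z X theta dtheta n)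
    & exact_at (@stab_conn C W Z X theta dtheta n)
        (cohom_map (stabcx_post W hx) (n := n + 1))].
Proof.
(* [v] and [u] both lift the identity of [B], so they are mutually inverse on stable cohomology. *)
have [v vE] : exists v : chainmap H Y, piY ∘ v 0 = twist_aug.
  exact: (chain_lift twist_projective resY (wr_aug twist_weak)).
have [u uE] : exists u : chainmap Y H, twist_aug ∘ u 0 = piY.
  exact: (chain_lift projY twist_weak (wr_aug resY)).
have vu k (z : cohom (stabcx W Y) k) :
    cohom_map (stabcx_post W v) (cohom_map (stabcx_post W u) z) = z.
  rewrite -stab_post_comp -[RHS]stab_post_id.
  by apply: (stab_post_unique projY resY); rewrite /= compmA vE uE compm1.
have uv k (z : cohom (stabcx W H) k) :
    cohom_map (stabcx_post W u) (cohom_map (stabcx_post W v) z) = z.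
  rewrite -stab_post_comp -[RHS]stab_post_id.
  apply: (stab_post_unique twist_projective twist_weak).
  by rewrite /= compmA uE vE compm1.
(* [hx] and the inclusion followed by [v] lift the same map, and likewise the projection and [v]
   followed by [hy]. *)
have hxV k (z : cohom (stabcx W X) k) : cohom_map (stabcx_post W hx) z =
    cohom_map (stabcx_post W v) (cohom_map (stabcx_post W (twist_in dtheta)) z).
  rewrite -stab_post_comp; apply: (stab_post_unique projX resY).
  by rewrite /= compmA vE hxE [RHS]copair_in1.
have hyV k (z : cohom (stabcx W H) k) :
    cohom_map (stabcx_post W (twist_pr dtheta)) z =
    cohom_map (stabcx_post W hy) (cohom_map (stabcx_post W v) z).
  rewrite -stab_post_comp; apply: (stab_post_unique twist_projective resZ).
  by rewrite /= compmA hyE -compmA vE aug_twist.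
(* The snake map of the twisted sum differs from [stab_conn] by a sign, which changes neither kernel
   nor image. *)
pose conn k (z : cohom (stabcx W Z) k) := stab_conn dtheta z *~ sgn (k + 1).
have connP k (z : cohom (stabcx W Z) k) := twist_connecting dtheta z.
have short := twist_short_exact dtheta W.
have E1 := exact_middle short; have E2 := exact_right short (conn := conn) connP.
have E3 := exact_left short (conn := conn) connP.
split.
- move=> b; rewrite -(vu _ b) -hyV; split=> [/E1 [a aE]|[a aE]].
    by exists a; rewrite hxV aE.
  by apply/E1; exists a; rewrite -(uv _ (cohom_map _ a)) -hxV aE uv.
- move=> c; have cE : stab_conn dtheta c = 0 <-> conn n c = 0.
    split=> [c0|/(congr1 (fun w => w *~ sgn (n + 1)))].
      by rewrite /conn c0 mul0rz.
    by rewrite /conn mulrz_sgnK mul0rz.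
  split=> [/cE/E2 [h hE]|[b bE]].
    by exists (cohom_map (stabcx_post W v) h); rewrite -hyV.
  by apply/cE/E2; exists (cohom_map (stabcx_post W u) b); rewrite hyV vu.
- move=> a; rewrite hxV; split=> [va|[c cE]].
    have [|c cE] := (E3 n a).1.
      rewrite -(uv _ (cohom_map _ a)) va (zmod_mor0 (@cohom_mapB _ _ _ _)) //.
    exists (c *~ sgn (n + 1)); rewrite (zmod_morMz _ _ (@stab_connB _ _ _ _ _ _ _)).
    exact: cE.
  have -> : cohom_map (stabcx_post W (twist_in dtheta)) a = 0.
    apply/E3; exists (c *~ sgn (n + 1)).
    by rewrite /conn (zmod_morMz _ _ (@stab_connB _ _ _ _ _ _ _)) mulrz_sgnK.
  exact: (zmod_mor0 (@cohom_mapB _ _ _ _)).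
Qed.

End Horseshoe.

(** * The connecting maps *)

Section Connecting.
Variables (C : extricat) (xi : properclass C).
Variable P : forall M : C, projres xi M.
Variable t : xitri xi.

Lemma theta_exists : exists2 theta : homcx (P (tC t)) (P (tA t)) 1,
  homcx_diff 1 (sub_val theta) = 0 &
  exists g, classifies (tx t) (ty t) (pr_aug (P (tA t))) (pr_aug (P (tC t))) theta g.
Proof.
apply: (classifies_exists (t_in t)).
- exact: projres_weak.
- exact: projres_weak.
- exact: projres_projective.
Qed.

(** Chosen once for each triangle, independently of [M], so that naturality in [M] involves no
    comparison of choices. *)
Definition theta : homcx (P (tC t)) (P (tA t)) 1 := s2val (cid2 theta_exists).

Lemma thetaP :
  exists g, classifies (tx t) (ty t) (pr_aug (P (tA t))) (pr_aug (P (tC t))) theta g.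
Proof. exact: (s2valP' (cid2 theta_exists)). Qed.

Lemma theta_cocycle : homcx_diff 1 (sub_val theta) = 0.
Proof. exact: (s2valP (cid2 theta_exists)). Qed.

Definition cext_conn_fun (M : C) (n : int) :
    cext P n M (tC t) -> cext P (n + 1) M (tA t) :=
  @stab_conn _ _ _ _ theta theta_cocycle n.

Fact cext_conn_funB M n : zmod_morphism (@cext_conn_fun M n).
Proof. exact: stab_connB. Qed.

Definition cext_conn (M : C) (n : int) :
    {additive cext P n M (tC t) -> cext P (n + 1) M (tA t)} :=
  HB.pack (@cext_conn_fun M n)
    (GRing.isZmodMorphism.Build _ _ (@cext_conn_fun M n) (@cext_conn_funB M n)).

(** The terms of [P M] are projective, so the snake construction can be carried out and [ext_conn]
    is not the default value of [choose_or]. *)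
Lemma ext_connP (M : C) (n : int) (u : ext P n M (tC t)) :
  connecting_rel (homN_post (P M) (tx t)) (homN_post (P M) (ty t)) u
    (ext_conn P n M t u).
Proof.
apply: (@choose_orP _ _ (fun w => connecting_rel _ _ u w)).
have proj := projres_projective (P M).
have [f uf] := represents_exists u.
have [_ _ sn] := proj n _ _ _ _ _ _ (t_in t); have [l lf] := sn f.
have [_ exn _] := proj (n + 1) _ _ _ _ _ _ (t_in t).
have [inj _ _] := proj (n + 1 + 1) _ _ _ _ _ _ (t_in t).
have [|k kl] := (exn (l ∘ cx_d (P M) (n + 1) n)).1.
  by rewrite compmA lf; exact: (represents_cocycle uf).
have [|w wk] := @cocycle_represents (homN (P M) (tA t)) (n + 1) k.
  apply: inj; rewrite comp0r /= /homN_d compmA kl -compmA cx_dd comp0r //.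
by exists w, l, k; split=> //=; rewrite lf.
Qed.

End Connecting.

(** * Naturality in the object and in the triangle *)

Section Naturality.
Variables (C : extricat) (xi : properclass C).
Variable P : forall M : C, projres xi M.

Lemma cext_conn_naturall (M M' : C) (f : mor M M') (t : xitri xi) (n : int)
    (z : cext P n M' (tC t)) :
  cext_conn P t M n (cext_mapl P n (tC t) f z) =
  cext_mapl P (n + 1) (tA t) f (cext_conn P t M' n z).
Proof. exact: stab_conn_pre. Qed.

(** The cocycle [chi] compares the two ways around the square formed by the two cocycles [theta] and
    the lifts of [a] and [c]. It is a coboundary by [homcx_null], so both ways agree on classes. *)
Lemma cext_conn_naturalr (M : C) (t t' : xitri xi)
    (a : mor (tA t) (tA t')) (b : mor (tB t) (tB t')) (c : mor (tC t) (tC t'))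
    (abc : tri_morphism a b c) (n : int) (z : cext P n M (tC t)) :
  cext_conn P t' M n (cext_mapr P n M c z) =
  cext_mapr P (n + 1) M a (cext_conn P t M n z).
Proof.
have [bx cy _] := abc.
have [g [yg xg]] := thetaP P t; have [g' [yg' xg']] := thetaP P t'.
set la := lift_chain (P (tA t)) (P (tA t')) a.
set lc := lift_chain (P (tC t)) (P (tC t')) c.
have laE : pr_aug (P (tA t')) ∘ la 0 = a ∘ pr_aug (P (tA t)) := lift_chainP _ _ _.
have lcE : pr_aug (P (tC t')) ∘ lc 0 = c ∘ pr_aug (P (tC t)) := lift_chainP _ _ _.
have projC := projres_projective (P (tC t)).
pose chi : homcx (P (tC t)) (P (tA t')) 1 :=
  homcx_pre (P (tA t')) lc 1 (theta P t') - homcx_post (P (tC t)) la 1 (theta P t).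
have chiE i j : sub_val chi i j =
    sub_val (theta P t') i j ∘ lc i - la j ∘ sub_val (theta P t) i j by [].
have dchi : homcx_diff 1 (sub_val chi) = 0.
  rewrite -homcx_dS /chi ab_dB !am_d.
  have -> : ab_d (homcx (P (tC t')) (P (tA t'))) 1 (1 + 1) (theta P t') = 0.
    by apply: sub_val_inj; rewrite homcx_dS theta_cocycle.
  have -> : ab_d (homcx (P (tC t)) (P (tA t))) 1 (1 + 1) (theta P t) = 0.
    by apply: sub_val_inj; rewrite homcx_dS theta_cocycle.
  by rewrite !(zmod_mor0 (@am_B _ _ _ _)) subrr.
have [_ ex0 _] := projC 0 _ _ _ _ _ _ (t_in t').
have [inj1 _ _] := projC 1 _ _ _ _ _ _ (t_in t').
(* [b g] and [g' lc] both lift [c] after the augmentation along [ty t'], so their difference factors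
   through [tx t']; the coboundary of [w] is the augmentation of [chi]. *)
have [|w wE] := (ex0 (b ∘ g - g' ∘ lc 0)).1.
  by rewrite compBr !compmA -cy yg' -compmA yg lcE subrr.
have [||s ds] := homcx_null projC (projres_weak (P (tA t')))
  (n := 0) (chi := chi) (w := w).
- exact: dchi.
- apply: inj1; rewrite [in RHS]compmA wE -[0 + 1]/(1 : int) chiE !compBr compBl.
  rewrite !compmA -[tx t' ∘ _ ∘ sub_val (theta P t') 1 0]compmA xg'.
  rewrite compNl -compmA cm_d compmA.
  rewrite -[tx t' ∘ _ ∘ la 0]compmA laE compmA -bx.
  rewrite -!compmA xg !compNr opprK addrC; congr (_ - _).
have [p zp] := stab_representative z.
have hr := stab_representsB
  (stab_conn_represents (theta_cocycle P t') (stab_post_represents lc zp))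
  (stab_post_represents la (stab_conn_represents (theta_cocycle P t) zp)).
apply/eqP; rewrite -subr_eq0; apply/eqP.
(* The factor matches the sign in [homcx_shift]. *)
apply: (stab_comp_coboundary (s := s *~ sgn (n + 1)) _ zp hr).
  by rewrite add0r.
rewrite sub_valMz (zmod_morMz _ _ (@homcx_diffB _ _ _ _)) ds.
apply: famP => i j.
transitivity (sub_val (homcx_shift (theta P t') (homcx_post (P M) lc n p)) i j -
  la j ∘ sub_val (homcx_shift (theta P t) p) i j) => //.
rewrite !homcx_shiftE [in RHS]/fam_comp !famMz -[0 + 1]/(1 : int) chiE.
by rewrite compMzr -mulrzBl compMzl compBl /fam_comp -!compmA.
Qed.

End Naturality.

(** * Complete resolutions and the comparison maps *)

Lemma eqhom_cancel (C : addcat) (A B D : C) (e : A = B) (f : mor B D) :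
  f ∘ eqhom e = 0 -> f = 0.
Proof. by case: _ / e f => f; rewrite compm1. Qed.

Lemma eqhom_symK (C : addcat) (A B : C) (e : A = B) :
  eqhom (esym e) ∘ eqhom e = idm A.
Proof. by case: _ / e; rewrite compm1. Qed.

Section Comparison.
Variables (C : extricat) (xi : properclass C).
Variable P : forall M : C, projres xi M.
Variables (M : C) (T : compres (P M)).

Let nu := cr_nu T.

Let projT i : xi_projective xi (T i).
Proof. by have [K []] := cr_complete T. Qed.

(** Modulo bounded families only entries with large first index count, and there [nu] is an identity
    up to transport. *)
Lemma stab_nu_inj (Y : complex C) n x : stabcx_pre Y nu n x = 0 -> x = 0.
Proof.
rewrite -(quo_reprK (x : quo_of (bounded (P M) Y n))); move: (quo_repr _) => p.
rewrite stab_pre_pi => /quo_pi0 [m hm]; have [b hb] := cr_id T.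
apply/quo_pi0; exists (Num.max b m) => i j; rewrite ge_max => /andP[bi mi].
have [e nuE] := hb i bi; have := hm i j mi.
by rewrite /= /nu nuE => /eqhom_cancel.
Qed.

Lemma stab_nu_surj (Y : complex C) n y : exists x, stabcx_pre Y nu n x = y.
Proof.
rewrite -(quo_reprK (y : quo_of (bounded T Y n))); move: (quo_repr _) => p.
have [b hb] := cr_id T.
(* A left inverse of [nu] in high degrees and zero below; the values below only change a family by a
   bounded one. *)
have ex i : {mu : mor (P M i) (T i) | b <= i -> mu ∘ nu i = idm (T i)}.
  apply: cid; have [bi|bi] := leP b i; last by exists 0.
  have [e nuE] := hb i bi; exists (eqhom (esym e)) => _.
  by rewrite /nu nuE eqhom_symK.
have deg : degree (P M) Y n (fun i j => sub_val p i j ∘ sval (ex i)).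
  by move=> i j ij; rewrite (subP p) // comp0l.
exists (quo_pi _ (to_sub deg)); rewrite stab_pre_pi; apply/quo_piP.
exists b => i j bi.
rewrite -[LHS]/(sub_val p i j ∘ sval (ex i) ∘ nu i - sub_val p i j).
rewrite -compmA (svalP (ex i) bi) compm1; exact: subrr.
Qed.

(** A cocycle [f] of C(T, N) lifts along the augmentation to a cocycle [phi] of the Hom complex,
    whose stable class comes from [P M] since [nu] induces a bijection. *)
Lemma ident_rel_total n N (w : cohom (homN T N) n) :
  exists z : cext P n M N, ident_rel z w.
Proof.
have [f wf] := represents_exists w.
have [||phi [dphi phiE]] := @homcx_lift C xi T (P N) N (pr_aug (P N)) projT
  (projres_weak (P N)) n 0 f.
- exact: (zmod_mor0 (@homcx_diffB _ _ _ _)).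
- have fd : f ∘ cx_d T (n + 1) n = 0 := represents_cocycle wf.
  by rewrite fd oppr0 mul0rz [LHS]comp0r.
have [|v vphi] := @cocycle_represents (homcx T (P N)) n phi.
  by apply: sub_val_inj; rewrite homcx_dS dphi.
have [z zE] := cohom_map_surj (@stab_nu_inj (P N)) (@stab_nu_surj (P N))
  (cohom_map (quocx_pi (bounded T (P N))) v).
by exists z, v, phi; rewrite phiE.
Qed.

(** By [homcx_null] the class of [phi] is determined by that of its augmentation, and [z] is then
    determined because [nu] induces an injection. *)
Lemma ident_rel_fun n N (z z' : cext P n M N) (w : cohom (homN T N) n) :
  ident_rel z w -> ident_rel z' w -> z = z'.
Proof.
case=> v [phi [vphi vz wphi]] [v' [phi' [vphi' vz' wphi']]].
apply: (cohom_map_inj (@stab_nu_inj (P N)) (@stab_nu_surj (P N))).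
rewrite -vz -vz'; congr cohom_map.
have [k nk] : exists k, n = k + 1 by exists (n - 1); rewrite subrK.
subst n; apply/(represents_eq (erefl _) vphi vphi').
have [t tE] := (represents_eq (erefl _) wphi wphi').1 erefl.
have [||s ds] := homcx_null projT (projres_weak (P N)) (n := k)
  (chi := phi - phi') (w := t).
- rewrite -homcx_dS ab_dB (represents_cocycle vphi) (represents_cocycle vphi').
  by rewrite subrr.
- by rewrite -[RHS]tE -[X in _ ∘ X]/(sub_val phi (k + 1) 0 - sub_val phi' (k + 1) 0)
    compBr.
by exists s; apply: sub_val_inj; rewrite homcx_dS ds.
Qed.

(** The witness is [phi] composed with [theta], so only augmentations remain to be compared. The
    augmented [phi] has two lifts along [ty t]: [g phi], and [l nu] corrected by a coboundary. Their
    difference factors through [tx t] as [q], and the coboundary of [- q] is the discrepancy between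
    the two cocycles in C(T, A). *)
Lemma ident_rel_conn (t : xitri xi) n (u : ext P n M (tC t))
    (z : cext P n M (tC t)) :
    ident_rel z (cohom_map (homN_pre (tC t) nu) u) ->
  ident_rel (cext_conn P t M n z)
    (cohom_map (homN_pre (tA t) nu) (ext_conn P n M t u)).
Proof.
case=> v [phi [vphi vz wphi]].
have [l [k [ul kl wk]]] := ext_connP u.
have [g [yg xg]] := thetaP P t.
set dt := theta_cocycle P t.
exists (cohom_shift (@homcx_shiftB _ _ _ _ (theta P t)) (homcx_shift_d dt) v).
exists (homcx_shift (theta P t) phi); split.
- exact: cohom_shift_represents.
- rewrite -[RHS](stab_conn_pre dt) -vz.
  have h := cohom_map_represents (quocx_pi (bounded T (P (tC t)))) vphi.
  apply: represents_fun (stab_conn_represents dt h).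
  by apply: cohom_map_represents; apply: cohom_shift_represents.
have [k' nk] : exists k', n = k' + 1 by exists (n - 1); rewrite subrK.
have ulnu := cohom_map_represents (homN_pre (tC t) nu) ul.
(* The augmented [phi] and the image of [l] precomposed with [nu] have the same class, so they
   differ by a coboundary, whose primitive [t0] is lifted to [t1]. *)
have [t0 t0E] := (represents_eq nk wphi ulnu).1 erefl.
have [_ _ srj] := projT k' (t_in t); have [t1 t1E] := srj t0.
have [_ exn _] := projT n (t_in t).
have [inj _ _] := projT (n + 1) (t_in t).
have [|q qE] := (exn (l ∘ nu n + t1 ∘ cx_d T n k' - g ∘ sub_val phi n 0)).1.
  rewrite compBr compDr !compmA yg t1E; apply/eqP; rewrite subr_eq0; apply/eqP.
  have := t0E; rewrite /= /homN_d => /eqP; rewrite subr_eq => /eqP ->.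
  by rewrite addrC.
have dphi : cx_d (P (tC t)) 1 0 ∘ sub_val phi (n + 1) 1 =
    (sub_val phi n 0 ∘ cx_d T (n + 1) n) *~ sgn n.
  have := congr1 (fun p : homcx T (P (tC t)) (n + 1) => sub_val p (n + 1) 0)
    (represents_cocycle vphi).
  rewrite homcx_dS /homcx_diff addrK => /eqP.
  by rewrite -[X in _ == X]/(0 : mor (T (n + 1)) (P (tC t) 0)) subr_eq0 => /eqP.
have kE : pr_aug (P (tA t)) ∘ sub_val (homcx_shift (theta P t) phi) (n + 1) 0 =
    k ∘ nu (n + 1) + (- q) ∘ cx_d T (n + 1) n.
  apply: inj.
  have kl' : tx t ∘ k = l ∘ cx_d (P M) (n + 1) n := kl.
  rewrite homcx_shiftE famMz /fam_comp add0r !compMzr.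
  rewrite [pr_aug _ ∘ (_ ∘ _)]compmA [tx t ∘ (_ ∘ _)]compmA xg compNl -compmA dphi.
  (* The minus sign of [classifies], the factor [sgn (n + 1)] of the shift and the [sgn n] of [dphi]
     cancel. *)
  rewrite compMzr sgnS mulNrz mulrNz opprK mulrz_sgnK.
  rewrite compDr compNl compNr ![tx t ∘ (_ ∘ _)]compmA kl' qE.
  rewrite compBl compDl -[t1 ∘ _ ∘ _]compmA cx_dd comp0r addr0.
  by rewrite -!compmA cm_d subKr.
rewrite kE; have := cohom_map_represents (homN_pre (tA t) nu) wk.
exact: (@represents_coboundary (homN T (tA t)) (n + 1) n _ _ (- q)).
Qed.

Lemma comparison_conn (t : xitri xi) n (u : ext P n M (tC t)) :
  cext_conn P t M n (comparison n (tC t) T u) =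
  comparison (n + 1) (tA t) T (ext_conn P n M t u).
Proof.
apply: ident_rel_fun (ident_rel_conn _) _.
  apply: (@choose_orP _ _ (fun z => ident_rel z _)); exact: ident_rel_total.
apply: (@choose_orP _ _ (fun z => ident_rel z _)); exact: ident_rel_total.
Qed.

End Comparison.

Theorem theorem3p9 (C : extricat) (hWIC : WIC C) (xi : properclass C)
    (hproj : enough_projectives xi) (hinj : enough_injectives xi)
    (P : forall M : C, projres xi M) :
  exists dt : forall (M : C), finite_Gpdim xi M ->
      forall (t : xitri xi) (n : int),
        {additive cext P n M (tC t) -> cext P (n + 1) M (tA t)},
    [/\ (* naturality in M *)
        (forall (M M' : C) (hM : finite_Gpdim xi M) (hM' : finite_Gpdim xi M')
           (f : mor M M') (t : xitri xi) (n : int) (z : cext P n M' (tC t)),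
           dt M hM t n (cext_mapl P n (tC t) f z) =
           cext_mapl P (n + 1) (tA t) f (dt M' hM' t n z)),
        (* naturality in the E-triangle *)
        (forall (M : C) (hM : finite_Gpdim xi M) (t t' : xitri xi)
           (a : mor (tA t) (tA t')) (b : mor (tB t) (tB t'))
           (c : mor (tC t) (tC t')), tri_morphism a b c ->
           forall (n : int) (z : cext P n M (tC t)),
             dt M hM t' n (cext_mapr P n M c z) =
             cext_mapr P (n + 1) M a (dt M hM t n z)),
        (* exactness of the long sequence *)
        (forall (M : C) (hM : finite_Gpdim xi M) (t : xitri xi) (n : int),
           [/\ exact_at (cext_mapr P n M (tx t)) (cext_mapr P n M (ty t)),
               exact_at (cext_mapr P n M (ty t)) (dt M hM t n)
             & exact_at (dt M hM t n) (cext_mapr P (n + 1) M (tx t))])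
      & (* compatibility with the comparison maps *)
        (forall (M : C) (hM : finite_Gpdim xi M) (T : compres (P M))
           (t : xitri xi) (n : int) (u : ext P n M (tC t)),
           dt M hM t n (comparison n (tC t) T u) =
           comparison (n + 1) (tA t) T (ext_conn P n M t u))].
Proof.
exists (fun M _ t n => cext_conn P t M n); split.
- by move=> M M' _ _ f t n z; exact: cext_conn_naturall.
- by move=> M _ t t' a b c abc n z; exact: cext_conn_naturalr abc n z.
- move=> M _ t n; have [g tg] := thetaP P t.
  have weak N := projres_weak (P N); have proj N := projres_projective (P N).
  exact: (stab_long_exact (t_in t) (weak _) (weak _) (proj _) (proj _)
    (theta_cocycle P t) tg (weak _) (proj _) (lift_chainP _ _ _) (lift_chainP _ _ _)).
- by move=> M _ T t n u; exact: comparison_conn.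
Qed.
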